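(* The maximum of the fourth normalized Steklov eigenvalue $\tilde\sigma_4(g)$ among all rotationally symmetric metrics $g=f(t)^2(dt^2+d\theta^2)$ on cylinders $[0,T]\times\mathbb{S}^1$ (all $T>0$) is achieved by the critical Möbius band, whose boundary meets the boundary of the ball orthogonally.
   Context: $\mathbb{S}^1=\mathbb{R}/2\pi\mathbb{Z}$; $f>0$ is smooth on $[0,T]$. For a compact Riemannian surface $(M,g)$ with nonempty boundary, the Dirichlet-to-Neumann map sends $u\in C^\infty(\partial M)$ to $\partial\hat u/\partial n$, with $\hat u$ the harmonic extension and $n$ the unit outward normal; its eigenvalues $0=\sigma_0(g)<\sigma_1(g)\le\sigma_2(g)\le\cdots$ (with multiplicity) are the Steklov eigenvalues, and $\tilde\sigma_k(g)=\sigma_k(g)L_g(\partial M)$, where $L_g(\partial M)$ is the length of $\partial M$. Let $T_{2,1}(1)$ be the unique positive root of $2\tanh(s)=\coth(s/2)$. The critical Möbius band is the surface in $\mathbb{R}^4$ parameterized by $X(t,\theta)=(2\sinh t\cos\theta,\ 2\sinh t\sin\theta,\ \cosh(2t)\cos(2\theta),\ \cosh(2t)\sin(2\theta))$ with $t\in[-T_{2,1}(1)/2,\ T_{2,1}(1)/2]$, $\theta\in\mathbb{S}^1$. The ball is the Euclidean ball centered at the origin whose boundary sphere contains the boundary of the surface. ''Achieved by'' this surface means: the cylinder $[-T_{2,1}(1)/2,T_{2,1}(1)/2]\times\mathbb{S}^1$ (identified with $[0,T_{2,1}(1)]\times\mathbb{S}^1$ by translation in $t$), with the metric induced by $X$ from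 the Euclidean metric, attains the maximum. *)

(* Defs.v *)
From Stdlib Require Import Reals ClassicalEpsilon.
From Coquelicot Require Import Coquelicot.
Open Scope R_scope.

(** The circle is R / 2 pi Z: functions on it are 2 pi-periodic functions on R.
    Functions on the cylinder [0,T] x S^1 are functions [u t theta] on R^2 that
    are 2 pi-periodic in [theta]; only their values for [0 <= t <= T] matter. *)

Definition periodic (h : R -> R) : Prop := forall x, h (x + 2 * PI) = h x.

Definition smooth (h : R -> R) : Prop := forall n x, ex_derive_n h n x.

(** Smoothness on a manifold with boundary: existence of a smooth extension. *)
Definition smooth_on (a b : R) (h : R -> R) : Prop :=
  exists H : R -> R, smooth H /\ forall x, a <= x <= b -> H x = h x.

(** All iterated partial derivatives exist and are continuous. *)
Definition smooth2 (u : R -> R -> R) : Prop := forall n x y, ex_diff_n u n x y.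

Definition d_t (u : R -> R -> R) (t th : R) : R := Derive (fun s => u s th) t.
Definition d_th (u : R -> R -> R) (t th : R) : R := Derive (fun w => u t w) th.

(** The metric [g_tt dt^2 + 2 g_tth dt dth + g_thth dth^2]. *)
Record metric := Metric {
  g_tt : R -> R -> R;
  g_tth : R -> R -> R;
  g_thth : R -> R -> R
}.

Definition sqrt_det (g : metric) (t th : R) : R :=
  sqrt (g_tt g t th * g_thth g t th - g_tth g t th ^ 2).

(** Laplace-Beltrami operator, [1/sqrt|g| d_i (sqrt|g| g^{ij} d_j u)]. *)
Definition laplacian (g : metric) (u : R -> R -> R) (t th : R) : R :=
  (d_t (fun t th => (g_thth g t th * d_t u t th - g_tth g t th * d_th u t th)
                    / sqrt_det g t th) t th
   + d_th (fun t th => (g_tt g t th * d_th u t th - g_tth g t th * d_t u t th)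
                       / sqrt_det g t th) t th)
  / sqrt_det g t th.

(** The two boundary circles [t = 0] and [t = T]. *)
Inductive side := Left | Right.

Definition side_pos (T : R) (s : side) : R :=
  match s with Left => 0 | Right => T end.

Definition side_sign (s : side) : R :=
  match s with Left => -1 | Right => 1 end.

(** Coordinates of the outward unit normal [+- grad t / |grad t|], where
    [grad t = (g_thth, - g_tth) / det g] and [|grad t|^2 = g_thth / det g]. *)
Definition normal_t (T : R) (g : metric) (s : side) (th : R) : R :=
  side_sign s * g_thth g (side_pos T s) th
  / (sqrt_det g (side_pos T s) th * sqrt (g_thth g (side_pos T s) th)).
Definition normal_th (T : R) (g : metric) (s : side) (th : R) : R :=
  side_sign s * - g_tth g (side_pos T s) th
  / (sqrt_det g (side_pos T s) th * sqrt (g_thth g (side_pos T s) th)).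

Definition normal_derivative (T : R) (g : metric) (u : R -> R -> R)
    (s : side) (th : R) : R :=
  normal_t T g s th * d_t u (side_pos T s) th
  + normal_th T g s th * d_th u (side_pos T s) th.

Definition boundary_length (T : R) (g : metric) : R :=
  RInt (fun th => sqrt (g_thth g 0 th)) 0 (2 * PI)
  + RInt (fun th => sqrt (g_thth g T th)) 0 (2 * PI).

Definition boundary_fun := side -> R -> R.

Definition smooth_boundary_fun (phi : boundary_fun) : Prop :=
  forall s, smooth (phi s) /\ periodic (phi s).

Definition harmonic_extension (T : R) (g : metric) (phi : boundary_fun)
    (u : R -> R -> R) : Prop :=
  smooth2 u
  /\ (forall t, periodic (u t))
  /\ (forall t th, 0 < t < T -> laplacian g u t th = 0)
  /\ (forall s th, u (side_pos T s) th = phi s th).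

(** Graph of the Dirichlet-to-Neumann map. *)
Definition dirichlet_to_neumann (T : R) (g : metric) (phi psi : boundary_fun)
    : Prop :=
  exists u, harmonic_extension T g phi u
    /\ forall s th, normal_derivative T g u s th = psi s th.

(** The eigenspace for [lam] (the zero function included). *)
Definition steklov_eigenspace (T : R) (g : metric) (lam : R)
    (phi : boundary_fun) : Prop :=
  smooth_boundary_fun phi
  /\ dirichlet_to_neumann T g phi (fun s th => lam * phi s th).

(** Linear independence of [phi 0, ..., phi m] ([sum_f_R0 _ m] has m+1 terms). *)
Definition lin_indep (m : nat) (phi : nat -> boundary_fun) : Prop :=
  forall c : nat -> R,
    (forall s th, sum_f_R0 (fun i => c i * phi i s th) m = 0) ->
    forall i, (i <= m)%nat -> c i = 0.

(** [sigma 0 <= sigma 1 <= ...] lists the eigenvalues with multiplicity: for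
    every [lam] and [m], the value [lam] occurs at least [m+1] times in the list
    iff its eigenspace has dimension at least [m+1]. *)
Definition steklov_spectrum (T : R) (g : metric) (sigma : nat -> R) : Prop :=
  (forall k, sigma k <= sigma (S k))
  /\ forall (lam : R) (m : nat),
      (exists idx : nat -> nat,
          (forall i j, (i <= m)%nat -> (j <= m)%nat -> idx i = idx j -> i = j)
          /\ forall i, (i <= m)%nat -> sigma (idx i) = lam)
      <->
      (exists phi : nat -> boundary_fun,
          (forall i, (i <= m)%nat -> steklov_eigenspace T g lam (phi i))
          /\ lin_indep m phi).

Definition steklov (T : R) (g : metric) : nat -> R :=
  epsilon (inhabits (fun _ : nat => 0)) (steklov_spectrum T g).

Definition normalized_steklov (T : R) (g : metric) (k : nat) : R :=
  steklov T g k * boundary_length T g.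

(** The restriction of [g] to [0,T] x S^1 is [f(t)^2 (dt^2 + dtheta^2)]. *)
Definition rotationally_symmetric (T : R) (g : metric) : Prop :=
  exists f : R -> R,
    smooth_on 0 T f
    /\ (forall t, 0 <= t <= T -> 0 < f t)
    /\ forall t th, 0 <= t <= T ->
        g_tt g t th = f t ^ 2 /\ g_tth g t th = 0 /\ g_thth g t th = f t ^ 2.

Record R4 := mkR4 { x1 : R; x2 : R; x3 : R; x4 : R }.

Definition dot (v w : R4) : R :=
  x1 v * x1 w + x2 v * x2 w + x3 v * x3 w + x4 v * x4 w.
Definition comb (a : R) (v : R4) (b : R) (w : R4) : R4 :=
  mkR4 (a * x1 v + b * x1 w) (a * x2 v + b * x2 w)
       (a * x3 v + b * x3 w) (a * x4 v + b * x4 w).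

Definition vec_map (D : (R -> R -> R) -> R -> R -> R) (Y : R -> R -> R4)
    (t th : R) : R4 :=
  mkR4 (D (fun s w => x1 (Y s w)) t th) (D (fun s w => x2 (Y s w)) t th)
       (D (fun s w => x3 (Y s w)) t th) (D (fun s w => x4 (Y s w)) t th).
Definition tangent_t := vec_map d_t.
Definition tangent_th := vec_map d_th.

Definition induced_metric (Y : R -> R -> R4) : metric :=
  Metric (fun t th => dot (tangent_t Y t th) (tangent_t Y t th))
         (fun t th => dot (tangent_t Y t th) (tangent_th Y t th))
         (fun t th => dot (tangent_th Y t th) (tangent_th Y t th)).

(** The surface [Y([a,b] x S^1)] has its boundary on the sphere of radius [r]
    centered at the origin and meets it orthogonally there: every vector tangent
    to the surface and normal to its boundary curve is orthogonal to the tangent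
    space of the sphere. *)
Definition meets_sphere_orthogonally (Y : R -> R -> R4) (a b r : R) : Prop :=
  forall t th, t = a \/ t = b ->
    dot (Y t th) (Y t th) = r ^ 2
    /\ forall p q : R,
        let nu := comb p (tangent_t Y t th) q (tangent_th Y t th) in
        dot nu (tangent_th Y t th) = 0 ->
        forall v : R4, dot v (Y t th) = 0 -> dot nu v = 0.

Definition coth (x : R) : R := cosh x / sinh x.

(** The unique positive root of [2 tanh s = coth (s/2)]. *)
Definition T21 : R :=
  epsilon (inhabits 0) (unique (fun s => 0 < s /\ 2 * tanh s = coth (s / 2))).

Definition moebius (t th : R) : R4 :=
  mkR4 (2 * sinh t * cos th) (2 * sinh t * sin th)
       (cosh (2 * t) * cos (2 * th)) (cosh (2 * t) * sin (2 * th)).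

(** Metric of the band, moved from [-T21/2, T21/2] to [0, T21]. *)
Definition critical_moebius_metric : metric :=
  induced_metric (fun t th => moebius (t - T21 / 2) th).

(* Main.v *)
Require Import Defs.
From Stdlib Require Import Reals Lra Lia List Classical ClassicalEpsilon.
From Stdlib Require Import FunctionalExtensionality.
From Coquelicot Require Import Coquelicot.
Import ListNotations.
Open Scope R_scope.

(** Harmonicity on a surface does not see a conformal factor, so for
    g = f^2 (dt^2 + dtheta^2) the Steklov problem involves f only through
    a = f 0 and b = f T: find u with u_tt + u_thth = 0, - u_t = lam a u on the
    left circle and u_t = lam b u on the right one.  Separation of variables
    solves it.  With K_n = cosh (n T) and S_n = sinh (n T) / n (S_0 = T), the
    Fourier modes cos (n theta), sin (n theta) carry the eigenvalue lam exactly
    when lam is a root of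
      S_n a b x^2 - K_n (a + b) x + n^2 S_n.
    This polynomial has two distinct roots eig n false < eig n true, each
    counted once for n = 0 and twice for n >= 1.

    These roots are the whole spectrum.  The value at the left circle of a
    Fourier coefficient of an eigenfunction determines its value at the right
    circle, and vanishes unless lam is a root for that frequency.  An
    eigenfunction with no Fourier coefficients on the left therefore has none on
    the right, hence is zero ([vanishing_fourier_coefficients]), and the
    eigenspace of lam has as many dimensions as there are modes with root lam
    ([multiplicity]).  Since the roots tend to infinity they can be listed in
    increasing order; this list is a Steklov spectrum, so [steklov] does satisfy
    its specification ([steklov_values]), and sigma_4 <= x (or >= x) can be read
    off by counting modes ([sorted_le], [sorted_ge]).

    The boundary has length 2 pi (a + b), so the claim is that the largest
    possible (a + b) sigma_4 is 2 sqrt 3.  The roots eig 0 false = 0 (once) and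
    eig 1 false (twice) are always at most x0 = 2 sqrt 3 / (a + b), and so is one
    of the double roots eig 2 false, eig 1 true: short cylinders make
    the former small, long ones the latter, or else a and b are so different that
    eig 2 false is small again ([eig_bound_crossing]).  That makes five
    modes with root at most x0.  When a = b the two curves are (2 / a) tanh T and
    (1 / a) coth (T / 2); they cross where 2 tanh T = coth (T / 2), that is, where
    cosh T = 2, and the common value there is sqrt 3 / a = x0.  At this length no
    more than four modes have a root below x0 ([symmetric_critical_lower]), so sigma_4 = x0.

    The band has the conformal metric with
    f^2 = 4 sinh^2 t + 4 cosh^2 (2 t), even about the middle circle, hence a = b,
    and its length is the critical one.  On its boundary sinh^2 t = 1/2 and
    cosh (2 t) = 2, which makes X_t a multiple of the position vector X
    ([moebius_free_boundary]): the band leaves the sphere of radius sqrt 6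
    orthogonally. *)

(** * Counting the values of a sequence with multiplicity *)

Definition takes (s : nat -> R) (lam : R) (k : nat) : Prop :=
  exists l, NoDup l /\ length l = k /\ forall i, In i l -> s i = lam.

Lemma takes_iff_injection (s : nat -> R) (lam : R) (m : nat) :
  takes s lam (S m) <->
  exists idx : nat -> nat,
    (forall i j, (i <= m)%nat -> (j <= m)%nat -> idx i = idx j -> i = j)
    /\ forall i, (i <= m)%nat -> s (idx i) = lam.
Proof.
  split.
  - intros (l & Hnd & Hlen & Hl). exists (fun i => nth i l 0%nat). split.
    + intros i j Hi Hj. apply NoDup_nth; auto; lia.
    + intros i Hi. apply Hl, nth_In. lia.
  - intros (idx & Hinj & Hval). exists (map idx (seq 0 (S m))). split; [|split].
    + apply NoDup_map_NoDup_ForallPairs; [|apply seq_NoDup].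
      intros i j Hi Hj. apply in_seq in Hi, Hj. apply Hinj; lia.
    + now rewrite length_map, length_seq.
    + intros i Hi. apply in_map_iff in Hi as (x & <- & Hx).
      apply in_seq in Hx. apply Hval. lia.
Qed.

Lemma NoDup_length_le_bound (l : list nat) (N : nat) :
  NoDup l -> (forall i, In i l -> (i < N)%nat) -> (length l <= N)%nat.
Proof.
  intros Hnd Hl. rewrite <- (length_seq N 0).
  apply NoDup_incl_length; auto.
  intros i Hi. apply in_seq. specialize (Hl i Hi). lia.
Qed.

Lemma NoDup_longer_new (l l' : list nat) :
  NoDup l -> (length l' < length l)%nat -> exists x, In x l /\ ~ In x l'.
Proof.
  intros Hnd Hlen. apply NNPP. intro Hno.
  assert (H : incl l l').
  { intros x Hx. apply NNPP. intro Hn. apply Hno. now exists x. }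
  apply NoDup_incl_length in H; auto. lia.
Qed.

Definition has_value (s : nat -> R) (lam : R) (i : nat) : bool :=
  if Req_EM_T (s i) lam then true else false.

Lemma has_value_spec s lam i : has_value s lam i = true <-> s i = lam.
Proof. unfold has_value. destruct (Req_EM_T (s i) lam); intuition congruence. Qed.

Lemma length_filter_has_value (s s' : nat -> R) (l l' : list nat) (lam : R) :
  map s l = map s' l' ->
  length (filter (has_value s lam) l) = length (filter (has_value s' lam) l').
Proof.
  revert l'. induction l as [|x l IH]; intros [|y l']; simpl; try discriminate; auto.
  intros [= Hxy Hl]. apply IH in Hl.
  replace (has_value s lam x) with (has_value s' lam y)
    by (unfold has_value; now rewrite Hxy).
  destruct (has_value s' lam y); simpl; congruence.
Qed.

(** Comparing multiplicities value by value is enough to match whole lists of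
    indices: each new index has a value that the other sequence takes more often
    than it has been used so far. *)
Lemma transport_indices (s s' : nat -> R) :
  (forall lam k, takes s lam (S k) -> takes s' lam (S k)) ->
  forall l, NoDup l -> exists l', NoDup l' /\ map s' l' = map s l.
Proof.
  intros Hs l. induction l as [|x l IH]; intros Hnd.
  { exists nil. split; [constructor|reflexivity]. }
  inversion Hnd as [|? ? Hx Hnd']; subst.
  destruct IH as (l' & Hnd1 & Hmap); auto.
  set (lx := filter (has_value s (s x)) l).
  destruct (Hs (s x) (length lx)) as (ly & Hndy & Hleny & Hy).
  { exists (x :: lx). split; [|split; [reflexivity|]].
    - constructor; [|now apply NoDup_filter].
      intro H. now apply filter_In in H as [H _].
    - intros i [<-|Hi]; auto. apply filter_In in Hi as [_ Hi].
      now apply has_value_spec. }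
  destruct (NoDup_longer_new ly (filter (has_value s' (s x)) l')) as (y & Hyl & Hyn).
  { auto. }
  { rewrite Hleny, (length_filter_has_value s' s l' l); auto. }
  exists (y :: l'). split.
  - constructor; auto. intro H. apply Hyn, filter_In. split; auto.
    now apply has_value_spec, Hy.
  - simpl. f_equal; auto.
Qed.

Definition tends_to_infinity (mu : nat -> R) : Prop :=
  forall B : R, exists N : nat, forall j, mu j <= B -> (j < N)%nat.

Lemma unused_minimum (mu : nat -> R) : tends_to_infinity mu ->
  forall l : list nat, exists j, ~ In j l /\ forall i, ~ In i l -> mu j <= mu i.
Proof.
  intros Hmu l.
  assert (H0 : exists j, ~ In j l).
  { destruct (NoDup_longer_new (seq 0 (S (length l))) l) as (x & _ & Hx).
    - apply seq_NoDup.
    - rewrite length_seq. lia.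
    - now exists x. }
  destruct H0 as (j0 & Hj0). destruct (Hmu (mu j0)) as (N & HN).
  assert (H : forall n, (exists j, ~ In j l /\ mu j <= mu j0 /\
    forall i, (i < n)%nat -> ~ In i l -> mu j <= mu i)).
  { induction n as [|n (j & Hj & Hle & IH)].
    - exists j0. repeat split; auto; [lra|lia].
    - destruct (classic (~ In n l /\ mu n < mu j)) as [[Hn Hlt]|Hn].
      + exists n. repeat split; auto; [lra|]. intros i Hi Hil.
        destruct (Nat.eq_dec i n) as [->|]; [lra|].
        specialize (IH i ltac:(lia) Hil). lra.
      + exists j. repeat split; auto. intros i Hi Hil.
        destruct (Nat.eq_dec i n) as [->|].
        * destruct (Rle_or_lt (mu j) (mu n)); auto. tauto.
        * apply IH; auto; lia. }
  destruct (H N) as (j & Hj & Hle & Hmin). exists j. split; auto.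
  intros i Hi. destruct (Rle_or_lt (mu j) (mu i)); auto.
  apply Hmin; auto. apply HN. lra.
Qed.

Fixpoint picked (next : list nat -> nat) (k : nat) : list nat :=
  match k with O => nil | S k' => next (picked next k') :: picked next k' end.

(** Greedy enumeration: [pi k] is an unused index of least value.  An index that
    were never reached would bound all values reached, against [tends_to_infinity]. *)
Lemma sorted_rearrangement (mu : nat -> R) : tends_to_infinity mu ->
  exists pi : nat -> nat,
    (forall k, mu (pi k) <= mu (pi (S k)))
    /\ (forall i j, pi i = pi j -> i = j)
    /\ (forall j, exists i, pi i = j).
Proof.
  intros Hmu.
  destruct (choice _ (unused_minimum mu Hmu)) as (next & Hnext).
  set (pi := fun k => next (picked next k)). exists pi.
  assert (Hin : forall k j, In j (picked next k) <-> exists i, (i < k)%nat /\ pi i = j).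
  { induction k as [|k IH]; intros j; simpl.
    - split; [tauto|]. intros (i & Hi & _). lia.
    - rewrite IH. split.
      + intros [H|(i & Hi & H)]; [exists k|exists i]; split; auto; lia.
      + intros (i & Hi & H). destruct (Nat.eq_dec i k) as [->|]; [now left|].
        right. exists i. split; auto; lia. }
  assert (Hlt : forall i j, (i < j)%nat -> pi i <> pi j).
  { intros i j Hij H. destruct (Hnext (picked next j)) as [Hn _].
    apply Hn, Hin. now exists i. }
  assert (Hinj : forall i j, pi i = pi j -> i = j).
  { intros i j H. destruct (Nat.lt_trichotomy i j) as [Hij|[Hij|Hij]]; auto;
    [|symmetry in H]; now apply Hlt in H. }
  split; [|split]; auto.
  - intros k. apply (proj2 (Hnext (picked next k))). rewrite Hin.
    intros (i & Hi & H). apply Hinj in H. lia.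
  - intros j. apply NNPP. intro Hno.
    destruct (Hmu (mu j)) as (N & HN).
    assert (H : (length (map pi (seq 0 (S N))) <= N)%nat).
    { apply NoDup_length_le_bound.
      - apply NoDup_map_NoDup_ForallPairs; [|apply seq_NoDup]. intros x y _ _. apply Hinj.
      - intros i Hi. apply in_map_iff in Hi as (x & <- & _). apply HN.
        apply (proj2 (Hnext (picked next x))). rewrite Hin.
        intros (i & _ & H). apply Hno. now exists i. }
    rewrite length_map, length_seq in H. lia.
Qed.

Lemma sorted_sequence (mu : nat -> R) : tends_to_infinity mu ->
  exists sigma : nat -> R,
    (forall k, sigma k <= sigma (S k))
    /\ forall lam k, takes sigma lam k <-> takes mu lam k.
Proof.
  intros Hmu. destruct (sorted_rearrangement mu Hmu) as (pi & Hmono & Hinj & Hsurj).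
  exists (fun k => mu (pi k)). split; auto. intros lam k. split.
  - intros (l & Hnd & Hlen & Hl). exists (map pi l). split; [|split].
    + apply NoDup_map_NoDup_ForallPairs; auto. intros x y _ _. apply Hinj.
    + now rewrite length_map.
    + intros i Hi. apply in_map_iff in Hi as (x & <- & Hx). now apply Hl.
  - intros (l & Hnd & Hlen & Hl).
    destruct (choice _ Hsurj) as (inv & Hinv).
    exists (map inv l). split; [|split].
    + apply NoDup_map_NoDup_ForallPairs; auto.
      intros x y _ _ H. now rewrite <- (Hinv x), <- (Hinv y), H.
    + now rewrite length_map.
    + intros i Hi. apply in_map_iff in Hi as (x & <- & Hx). rewrite Hinv. auto.
Qed.

Lemma monotone_le (s : nat -> R) : (forall k, s k <= s (S k)) ->
  forall i j, (i <= j)%nat -> s i <= s j.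
Proof.
  intros Hs i j Hij. induction Hij; [lra|]. specialize (Hs m). lra.
Qed.

(** Only the multiplicities of [mu] are compared with those of the sorted sequence
    [s]; k+1 indices of [mu] with value at most [M] yield k+1 indices of [s], and one
    of them is at least [k]. *)
Lemma sorted_le (s mu : nat -> R) (M : R) (l : list nat) (k : nat) :
  (forall k, s k <= s (S k)) ->
  (forall lam k, takes s lam (S k) <-> takes mu lam (S k)) ->
  NoDup l -> length l = S k -> (forall j, In j l -> mu j <= M) -> s k <= M.
Proof.
  intros Hmono Heq Hnd Hlen Hl.
  destruct (transport_indices mu s) with (l := l) as (l' & Hnd' & Hmap); auto.
  { intros lam i. apply Heq. }
  assert (H : exists i, In i l' /\ (k <= i)%nat).
  { apply NNPP. intro Hno.
    assert (H : (length l' <= k)%nat).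
    { apply NoDup_length_le_bound; auto. intros i Hi.
      destruct (Nat.lt_ge_cases i k); auto. exfalso. apply Hno. now exists i. }
    apply (f_equal (@length R)) in Hmap. rewrite !length_map in Hmap. lia. }
  destruct H as (i & Hi & Hki).
  apply Rle_trans with (s i). { now apply monotone_le. }
  apply (in_map s) in Hi. rewrite Hmap in Hi.
  apply in_map_iff in Hi as (j & <- & Hj). auto.
Qed.

Lemma sorted_ge (s mu : nat -> R) (M : R) (l : list nat) (k : nat) :
  (forall k, s k <= s (S k)) ->
  (forall lam k, takes s lam (S k) <-> takes mu lam (S k)) ->
  length l = k -> (forall j, ~ In j l -> M <= mu j) -> M <= s k.
Proof.
  intros Hmono Heq Hlen Hl. destruct (Rle_or_lt M (s k)) as [|Hlt]; auto. exfalso.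
  destruct (transport_indices s mu) with (l := seq 0 (S k)) as (l' & Hnd' & Hmap).
  { intros lam i. apply Heq. }
  { apply seq_NoDup. }
  destruct (NoDup_longer_new l' l) as (j & Hj & Hjn); auto.
  { apply (f_equal (@length R)) in Hmap. rewrite !length_map, length_seq in Hmap. lia. }
  specialize (Hl j Hjn).
  apply (in_map mu) in Hj. rewrite Hmap in Hj.
  apply in_map_iff in Hj as (i & Hi & Hik). apply in_seq in Hik.
  assert (s i <= s k) by (apply monotone_le; auto; lia). lra.
Qed.

Definition skip (p i : nat) : nat := if (i <? p)%nat then i else S i.

Lemma sum_skip (f : nat -> R) (p K : nat) : (p <= S K)%nat ->
  sum_f_R0 f (S K) = f p + sum_f_R0 (fun i => f (skip p i)) K.
Proof.
  assert (Hlast : forall K, sum_f_R0 (fun i => f (skip (S K) i)) K = sum_f_R0 f K).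
  { intros K'. apply sum_eq. intros i Hi. unfold skip.
    destruct (Nat.ltb_spec i (S K')); auto; lia. }
  revert p. induction K as [|K IH]; intros p Hp.
  - destruct (Nat.eq_dec p 1) as [->|].
    + rewrite Hlast. simpl. lra.
    + replace p with 0%nat by lia. reflexivity.
  - destruct (Nat.eq_dec p (S (S K))) as [->|].
    + rewrite tech5, Hlast. lra.
    + rewrite tech5, (IH p) by lia. rewrite (tech5 _ K).
      replace (skip p (S K)) with (S (S K)); [lra|].
      unfold skip. destruct (Nat.ltb_spec (S K) p); auto; lia.
Qed.

(** More unknowns than equations: Gaussian elimination of one unknown by means of
    the last equation. *)
Lemma homogeneous_system (K : nat) : forall A : nat -> nat -> R,
  exists c : nat -> R, (exists i, (i <= K)%nat /\ c i <> 0)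
    /\ forall j, (j < K)%nat -> sum_f_R0 (fun i => c i * A i j) K = 0.
Proof.
  induction K as [|K IH]; intros A.
  { exists (fun _ => 1). split; [exists 0%nat; split; auto; lra|intros j Hj; lia]. }
  destruct (classic (exists p, (p <= S K)%nat /\ A p K <> 0)) as [(p & Hp & HA)|Hno].
  - destruct (IH (fun i j => A (skip p i) j - A (skip p i) K / A p K * A p j))
      as (c & (i0 & Hi0 & Hc0) & Hc).
    set (d := fun x => if Nat.eq_dec x p
      then - sum_f_R0 (fun i => c i * A (skip p i) K) K / A p K
      else if (x <? p)%nat then c x else c (pred x)).
    assert (Hd : forall i, d (skip p i) = c i).
    { intros i. unfold d, skip. destruct (Nat.ltb_spec i p).
      - destruct (Nat.eq_dec i p); [lia|]. destruct (Nat.ltb_spec i p); auto; lia.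
      - destruct (Nat.eq_dec (S i) p); [lia|]. destruct (Nat.ltb_spec (S i) p); auto; lia. }
    assert (Hdp : d p = - sum_f_R0 (fun i => c i * A (skip p i) K) K / A p K).
    { unfold d. destruct (Nat.eq_dec p p); auto. congruence. }
    exists d. split.
    + exists (skip p i0). rewrite Hd. split; auto.
      unfold skip. destruct (i0 <? p)%nat; lia.
    + intros j Hj. rewrite (sum_skip _ p) by lia. cbv beta. rewrite Hdp.
      rewrite (sum_eq (fun i => d (skip p i) * A (skip p i) j)
        (fun i => c i * A (skip p i) j)) by (intros i Hi; now rewrite Hd).
      assert (Hj' : sum_f_R0 (fun i => c i * A (skip p i) j) K
        = sum_f_R0 (fun i => c i * A (skip p i) K) K * (A p j / A p K)).
      { destruct (Nat.eq_dec j K) as [->|].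
        - field; auto.
        - specialize (Hc j ltac:(lia)).
          rewrite <- (Rplus_0_r (_ * _)), <- Hc, Rmult_comm, scal_sum, <- sum_plus.
          apply sum_eq. intros i Hi. field; auto. }
      rewrite Hj'. field; auto.
  - assert (HA : forall i, (i <= S K)%nat -> A i K = 0).
    { intros i Hi. apply NNPP. intro H. apply Hno. now exists i. }
    destruct (IH A) as (c & (i0 & Hi0 & Hc0) & Hc).
    exists (fun i => if (i <=? K)%nat then c i else 0). split.
    + exists i0. split; [lia|]. destruct (Nat.leb_spec i0 K); auto; lia.
    + intros j Hj. rewrite tech5. destruct (Nat.leb_spec (S K) K); [lia|].
      rewrite Rmult_0_l, Rplus_0_r.
      rewrite (sum_eq _ (fun i => c i * A i j))
        by (intros i Hi; destruct (Nat.leb_spec i K); auto; lia).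
      destruct (Nat.eq_dec j K) as [->|]; [|apply Hc; lia].
      rewrite (sum_eq _ (fun _ => 0)), sum_cte; [ring|].
      intros i Hi. rewrite HA by lia. ring.
Qed.

(** * Fourier coefficients determine a continuous periodic function *)

Definition trig (c : bool) (n : nat) (x : R) : R :=
  if c then cos (INR n * x) else sin (INR n * x).

Definition dtrig (c : bool) (n : nat) (x : R) : R :=
  if c then - (INR n * sin (INR n * x)) else INR n * cos (INR n * x).

Lemma is_derive_trig c n x : is_derive (trig c n) x (dtrig c n x).
Proof. unfold trig, dtrig; destruct c; auto_derive; auto; ring. Qed.

Lemma is_derive_dtrig c n x :
  is_derive (dtrig c n) x (- INR n ^ 2 * trig c n x).
Proof. unfold trig, dtrig; destruct c; auto_derive; auto; ring. Qed.

Lemma continuous_of_derive (f df : R -> R) x :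
  is_derive f x (df x) -> continuous f x.
Proof. intros H. apply (ex_derive_continuous f). now exists (df x). Qed.

Lemma continuous_trig c n x : continuous (trig c n) x.
Proof. apply (continuous_of_derive _ (dtrig c n)), is_derive_trig. Qed.

Lemma sin_cos_2nPI n : sin (INR n * (2 * PI)) = 0 /\ cos (INR n * (2 * PI)) = 1.
Proof.
  replace (INR n * (2 * PI)) with (0 + 2 * INR n * PI) by ring.
  rewrite sin_period, cos_period, sin_0, cos_0. auto.
Qed.

Lemma periodic_trig c n : periodic (trig c n).
Proof.
  intros x. destruct (sin_cos_2nPI n) as [Hs Hc].
  unfold trig; destruct c; rewrite Rmult_plus_distr_l, ?cos_plus, ?sin_plus, Hs, Hc; ring.
Qed.

Lemma periodic_dtrig c n : periodic (dtrig c n).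
Proof.
  intros x. destruct (sin_cos_2nPI n) as [Hs Hc].
  unfold dtrig; destruct c; rewrite Rmult_plus_distr_l, ?cos_plus, ?sin_plus, Hs, Hc; ring.
Qed.

Definition period_int (f : R -> R) : R := RInt f 0 (2 * PI).

Lemma ex_RInt_cont (f : R -> R) a b : (forall x, continuous f x) -> ex_RInt f a b.
Proof. intros H. apply (@ex_RInt_continuous R_CompleteNormedModule). auto. Qed.

Lemma period_int_ext f g : (forall x, f x = g x) -> period_int f = period_int g.
Proof. intros H. apply RInt_ext. auto. Qed.

Lemma period_int_lin (f g : R -> R) (a b : R) :
  (forall x, continuous f x) -> (forall x, continuous g x) ->
  period_int (fun x => a * f x + b * g x) = a * period_int f + b * period_int g.
Proof.
  intros Hf Hg. unfold period_int.
  rewrite (RInt_plus (fun x => a * f x) (fun x => b * g x)).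
  - rewrite (RInt_scal f _ _ a), (RInt_scal g _ _ b); try reflexivity;
      now apply ex_RInt_cont.
  - apply (ex_RInt_scal f). now apply ex_RInt_cont.
  - apply (ex_RInt_scal g). now apply ex_RInt_cont.
Qed.

Lemma period_int_derive (f df : R -> R) :
  periodic f -> (forall x, is_derive f x (df x)) -> (forall x, continuous df x) ->
  period_int df = 0.
Proof.
  intros Hp Hd Hc. apply is_RInt_unique.
  assert (H0 : minus (f (2 * PI)) (f 0) = 0).
  { unfold minus, plus, opp; simpl. rewrite <- (Rplus_0_l (2 * PI)), Hp. ring. }
  refine (eq_rect _ (is_RInt df 0 (2 * PI)) _ _ H0).
  apply (is_RInt_derive f df); auto.
Qed.

Lemma continuous_Rmult (f g : R -> R) x :
  continuous f x -> continuous g x -> continuous (fun x => f x * g x) x.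
Proof. apply (continuous_mult f g). Qed.

Lemma continuous_Rplus (f g : R -> R) x :
  continuous f x -> continuous g x -> continuous (fun x => f x + g x) x.
Proof. apply (continuous_plus f g). Qed.

Ltac cont := intros; lazymatch goal with
  | |- continuous (fun x => @?f x + @?g x) _ =>
      apply (continuous_Rplus f g); cbv beta; cont
  | |- continuous (fun x => @?f x * @?g x) _ =>
      apply (continuous_Rmult f g); cbv beta; cont
  | |- continuous (fun _ => ?c) _ => apply continuous_const
  | |- continuous (fun x => trig ?c ?n x) _ => apply (continuous_trig c n)
  | _ => auto
  end.

Lemma period_int_scal (f : R -> R) (k : R) : (forall x, continuous f x) ->
  period_int (fun x => k * f x) = k * period_int f.
Proof.
  intros Hf. rewrite (period_int_ext _ (fun x => k * f x + 0 * f x)) by (intros; ring).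
  rewrite period_int_lin by auto. ring.
Qed.

Lemma period_int_0 (f : R -> R) : (forall x, f x = 0) -> period_int f = 0.
Proof.
  intros Hf. rewrite (period_int_ext f (fun x => 0 * 1)) by (intros; rewrite Hf; ring).
  rewrite (period_int_scal (fun _ => 1)) by cont. ring.
Qed.

Lemma trig_mult (c d : bool) (n : nat) : exists al be e k l,
  forall x, trig c 1 x * trig d n x = al * trig e k x + be * trig e l x.
Proof.
  destruct n as [|n].
  - destruct d.
    + exists 1, 0, c, 1%nat, 1%nat. intros x. unfold trig at 2. simpl.
      rewrite Rmult_0_l, cos_0. ring.
    + exists 0, 0, c, 1%nat, 1%nat. intros x. unfold trig at 2. simpl.
      rewrite Rmult_0_l, sin_0. ring.
  - assert (Hk : forall x, INR (S (S n)) * x = INR (S n) * x + x)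
      by (intros; rewrite (S_INR (S n)); ring).
    assert (Hl : forall x, INR n * x = INR (S n) * x - x)
      by (intros; rewrite (S_INR n); ring).
    set (al := if c then / 2 else if d then / 2 else - / 2).
    set (be := if c then / 2 else if d then - / 2 else / 2).
    exists al, be, (Bool.eqb c d), (S (S n)), n. intros x. unfold trig.
    replace (INR 1 * x) with x by (simpl; ring).
    rewrite Hk, Hl. unfold al, be.
    destruct c, d; simpl Bool.eqb; cbv iota;
      rewrite ?cos_plus, ?sin_plus, ?cos_minus, ?sin_minus; field.
Qed.

Definition annihilates (h p : R -> R) : Prop :=
  forall c n, period_int (fun x => h x * p x * trig c n x) = 0.

(** Product formulas turn [trig] times [trig] into a sum, so the multipliers that
    keep all Fourier coefficients of [h] zero are stable under multiplication by
    first-order trigonometric polynomials: from the constant 1 one reaches their powers. *)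
Lemma annihilates_mult (h p : R -> R) (A B C : R) :
  (forall x, continuous h x) -> (forall x, continuous p x) -> annihilates h p ->
  annihilates h (fun x => p x * (A + B * trig true 1 x + C * trig false 1 x)).
Proof.
  intros Hh Hp Ha d n.
  destruct (trig_mult true d n) as (a1 & b1 & e1 & k1 & l1 & H1).
  destruct (trig_mult false d n) as (a2 & b2 & e2 & k2 & l2 & H2).
  set (F := fun e k x => h x * p x * trig e k x).
  rewrite (period_int_ext _ (fun x => A * F d n x
    + 1 * (B * (a1 * F e1 k1 x + b1 * F e1 l1 x)
           + C * (a2 * F e2 k2 x + b2 * F e2 l2 x)))).
  2:{ intros x. unfold F.
      transitivity (h x * p x * (A * trig d n x + B * (trig true 1 x * trig d n x)
        + C * (trig false 1 x * trig d n x))); [ring|]. rewrite H1, H2. ring. }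
  assert (Hc : forall e k x, continuous (F e k) x) by (unfold F; cont).
  assert (Hi : forall e k, period_int (F e k) = 0) by (intros; apply Ha).
  clearbody F.
  rewrite period_int_lin by cont.
  rewrite (period_int_lin (fun x => a1 * F e1 k1 x + b1 * F e1 l1 x)
      (fun x => a2 * F e2 k2 x + b2 * F e2 l2 x))
    by cont.
  rewrite !period_int_lin by auto. rewrite !Hi. ring.
Qed.

Lemma annihilates_pow (h : R -> R) (x0 d : R) (k : nat) :
  (forall x, continuous h x) -> annihilates h (fun _ => 1) ->
  (forall x, continuous (fun x => (1 - cos d + cos (x - x0)) ^ k) x) /\
  annihilates h (fun x => (1 - cos d + cos (x - x0)) ^ k).
Proof.
  intros Hh H1.
  assert (Hq : forall x, 1 - cos d + cos (x - x0) =
    1 - cos d + cos x0 * trig true 1 x + sin x0 * trig false 1 x).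
  { intros x. unfold trig. rewrite cos_minus. simpl INR. rewrite Rmult_1_l. ring. }
  induction k as [|k [IHc IH]]; split.
  - intros x. apply continuous_const.
  - exact H1.
  - intros x. apply (continuous_Rmult (fun x => 1 - cos d + cos (x - x0))); [|apply IHc].
    apply (continuous_ext (fun x =>
      (1 - cos d) + (cos x0 * trig true 1 x + sin x0 * trig false 1 x))).
    + intros y. rewrite Hq. simpl. ring.
    + cont.
  - intros c n. rewrite <- (annihilates_mult h _ (1 - cos d) (cos x0) (sin x0) Hh IHc IH c n).
    apply period_int_ext. intros x. rewrite <- Hq. simpl. ring.
Qed.

Lemma bounded_on_period (h : R -> R) : (forall x, continuous h x) ->
  exists B, 0 < B /\ forall x, 0 <= x <= 2 * PI -> Rabs (h x) <= B.
Proof.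
  intros Hh. pose proof PI_RGT_0.
  destruct (continuity_ab_maj (fun x => Rabs (h x)) 0 (2 * PI)) as (m & Hm & _).
  - lra.
  - intros x _. apply continuity_pt_filterlim.
    apply (continuous_comp h Rabs); [apply Hh|apply continuous_Rabs].
  - exists (Rabs (h m) + 1). split; [pose proof (Rabs_pos (h m)); lra|].
    intros x Hx. specialize (Hm x Hx). simpl in Hm. lra.
Qed.

Lemma cos_Rabs y : cos (Rabs y) = cos y.
Proof. unfold Rabs. destruct (Rcase_abs y); auto. apply cos_neg. Qed.

(** The kernel q = 1 - cos d + cos (x - x0) has modulus at most 1 at distance at
    least [d] from [x0] and exceeds 1 nearer to [x0].  If [h] is positive there, the
    integral of [h * q ^ k] grows with [k], so it cannot be zero for all [k]. *)
Lemma positive_pairs_with_bump (h : R -> R) (x0 d e : R) :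
  (forall x, continuous h x) -> 0 < d -> 0 < e -> d <= x0 <= 2 * PI - d ->
  (forall x, Rabs (x - x0) <= d -> e <= h x) ->
  ~ annihilates h (fun _ => 1).
Proof.
  intros Hh Hd He Hx0 Hpos Hann. pose proof PI_RGT_0 as Hpi.
  set (q := fun x => 1 - cos d + cos (x - x0)).
  destruct (bounded_on_period h Hh) as (B & HB & HhB).
  set (eta := cos (d / 2) - cos d).
  assert (Heta : 0 < eta).
  { unfold eta. assert (cos d < cos (d / 2)) by (apply cos_decreasing_1; lra). lra. }
  assert (Hcos_in : forall r y, 0 <= r <= PI -> Rabs y <= r -> cos r <= cos y).
  { intros r y Hr Hy. rewrite <- (cos_Rabs y).
    pose proof (Rabs_pos y). apply cos_decr_1; lra. }
  assert (Hout : forall x, 0 <= x <= 2 * PI -> d <= Rabs (x - x0) -> Rabs (q x) <= 1).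
  { intros x Hx Hdx. unfold q. pose proof (COS_bound (x - x0)). pose proof (COS_bound d).
    assert (cos (x - x0) <= cos d).
    { rewrite <- cos_Rabs.
      set (y := Rabs (x - x0)) in *.
      assert (Hy : y <= 2 * PI - d) by (unfold y; apply Rabs_le; lra).
      destruct (Rle_or_lt y PI).
      - apply cos_decr_1; lra.
      - replace (cos y) with (cos (2 * PI - y)).
        + apply cos_decr_1; lra.
        + rewrite cos_minus, sin_2PI, cos_2PI. ring. }
    apply Rabs_le. lra. }
  assert (Hlow : forall k x, 0 <= x <= 2 * PI -> - B <= h x * q x ^ k).
  { intros k x Hx. destruct (Rle_or_lt (Rabs (x - x0)) d) as [Hin|Hin].
    - apply Rle_trans with 0; [lra|]. apply Rmult_le_pos.
      + specialize (Hpos x Hin). lra.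
      + apply pow_le. unfold q. specialize (Hcos_in d (x - x0) ltac:(lra) Hin).
        lra.
    - specialize (Hout x Hx ltac:(lra)). specialize (HhB x Hx).
      assert (H : Rabs (h x * q x ^ k) <= B * 1).
      { rewrite Rabs_mult. apply Rmult_le_compat; auto using Rabs_pos.
        rewrite <- RPow_abs, <- (pow1 k). apply pow_incr. split; auto using Rabs_pos. }
      apply Rabs_le_between in H. lra. }
  assert (Hmid : forall k x, x0 - d / 2 <= x <= x0 + d / 2 ->
      e * (1 + INR k * eta) <= h x * q x ^ k).
  { intros k x Hx.
    assert (Hxd : Rabs (x - x0) <= d / 2) by (apply Rabs_le; lra).
    apply Rmult_le_compat; [lra| | |].
    - pose proof (pos_INR k). pose proof (Rmult_le_pos (INR k) eta). lra.
    - apply Hpos. lra.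
    - apply Rle_trans with ((1 + eta) ^ k); [now apply poly|].
      apply pow_incr. split; [lra|]. unfold eta, q.
      specialize (Hcos_in (d / 2) (x - x0) ltac:(lra) Hxd). lra. }
  assert (Hcont : forall k x, continuous (fun x => h x * q x ^ k) x).
  { intros k x. apply continuous_Rmult; auto. apply (annihilates_pow h x0 d k Hh Hann). }
  assert (Hex : forall k a b, ex_RInt (fun x => h x * q x ^ k) a b)
    by (intros; apply ex_RInt_cont, Hcont).
  assert (Hint : forall k, d * (e * (1 + INR k * eta)) - 2 * PI * B <= 0).
  { intros k.
    assert (Hzero : period_int (fun x => h x * q x ^ k) = 0).
    { rewrite <- (proj2 (annihilates_pow h x0 d k Hh Hann) true 0%nat).
      apply period_int_ext. intros x. unfold trig, q. simpl INR.
      rewrite Rmult_0_l, cos_0. ring. }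
    assert (Hge : forall v a b, a <= b -> (forall x, a < x < b -> v <= h x * q x ^ k) ->
      (b - a) * v <= RInt (fun x => h x * q x ^ k) a b).
    { intros v a b Hab Hv.
      replace ((b - a) * v) with (RInt (fun _ => v) a b)
        by (rewrite RInt_const; reflexivity).
      apply RInt_le; auto. apply ex_RInt_const. }
    unfold period_int in Hzero.
    rewrite <- (RInt_Chasles _ 0 (x0 - d / 2) (2 * PI)) in Hzero by auto.
    rewrite <- (RInt_Chasles _ (x0 - d / 2) (x0 + d / 2) (2 * PI)) in Hzero by auto.
    unfold plus in Hzero; simpl in Hzero.
    pose proof (Hge (- B) 0 (x0 - d / 2) ltac:(lra) ltac:(intros; apply Hlow; lra)) as G1.
    pose proof (Hge (e * (1 + INR k * eta)) (x0 - d / 2) (x0 + d / 2) ltac:(lra)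
      ltac:(intros; apply Hmid; lra)) as G2.
    pose proof (Hge (- B) (x0 + d / 2) (2 * PI) ltac:(lra) ltac:(intros; apply Hlow; lra)) as G3.
    assert (0 < d * B) by (now apply Rmult_lt_0_compat). nra. }
  destruct (INR_unbounded (2 * PI * B / (d * e * eta))) as (k & Hk).
  specialize (Hint k).
  assert (Hde : 0 < d * e) by (apply Rmult_lt_0_compat; lra).
  assert (Hdee : 0 < d * e * eta) by (apply Rmult_lt_0_compat; lra).
  apply (Rmult_lt_compat_l (d * e * eta)) in Hk; auto.
  replace (d * e * eta * (2 * PI * B / (d * e * eta))) with (2 * PI * B) in Hk
    by (field; repeat split; lra).
  nra.
Qed.

Lemma vanishing_fourier_coefficients (h : R -> R) :
  (forall x, continuous h x) -> periodic h ->
  (forall c n, period_int (fun x => h x * trig c n x) = 0) ->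
  forall x, h x = 0.
Proof.
  intros Hh Hper Hz. pose proof PI_RGT_0 as Hpi.
  assert (Hann : annihilates h (fun _ => 1)).
  { intros c n. rewrite <- (Hz c n). apply period_int_ext. intros; ring. }
  assert (Hann' : annihilates (fun x => - h x) (fun _ => 1)).
  { intros c n. rewrite (period_int_ext _ (fun x => -1 * (h x * trig c n x)))
      by (intros; ring).
    rewrite period_int_scal by cont. rewrite Hz. ring. }
  assert (Hh' : forall x, continuous (fun x => - h x) x)
    by (intros x; apply (continuous_opp h), Hh).
  assert (Hnear : forall x0 e, 0 < e -> exists d, 0 < d /\
    forall x, Rabs (x - x0) <= d -> Rabs (h x - h x0) <= e).
  { intros x0 e He.
    destruct (proj1 (filterlim_locally h (h x0)) (Hh x0) (mkposreal e He)) as (d & Hd).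
    exists (d / 2). pose proof (cond_pos d). split; [lra|].
    intros x Hx. left. apply Hd. change (Rabs (x - x0) < d). lra. }
  assert (Hint : forall x, 0 < x < 2 * PI -> h x = 0).
  { intros x0 Hx0. apply NNPP. intro Hne.
    set (e := Rabs (h x0) / 2).
    assert (He : 0 < e) by (unfold e; pose proof (Rabs_pos_lt _ Hne); lra).
    destruct (Hnear x0 e He) as (d0 & Hd0 & Hd).
    set (d := Rmin d0 (Rmin x0 (2 * PI - x0))).
    assert (Hdpos : 0 < d /\ d <= d0 /\ d <= x0 <= 2 * PI - d).
    { unfold d. pose proof (Rmin_l d0 (Rmin x0 (2 * PI - x0))).
      pose proof (Rmin_r d0 (Rmin x0 (2 * PI - x0))).
      pose proof (Rmin_l x0 (2 * PI - x0)). pose proof (Rmin_r x0 (2 * PI - x0)).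
      split; [|lra]. repeat apply Rmin_glb_lt; lra. }
    destruct (Rlt_or_le 0 (h x0)) as [Hs|Hs].
    - apply (positive_pairs_with_bump h x0 d e); try tauto.
      intros x Hx. specialize (Hd x ltac:(lra)). apply Rabs_le_between in Hd.
      unfold e in *. rewrite (Rabs_pos_eq (h x0)) in * by lra. lra.
    - apply (positive_pairs_with_bump (fun x => - h x) x0 d e); try tauto.
      intros x Hx. specialize (Hd x ltac:(lra)). apply Rabs_le_between in Hd.
      unfold e in *. rewrite (Rabs_left1 (h x0)) in * by lra. lra. }
  assert (H0 : h 0 = 0).
  { apply NNPP. intro Hne.
    destruct (Hnear 0 (Rabs (h 0) / 2)) as (d0 & Hd0 & Hd).
    { pose proof (Rabs_pos_lt _ Hne); lra. }
    set (y := Rmin d0 PI).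
    assert (Hy : 0 < y <= d0 /\ y <= PI).
    { unfold y. pose proof (Rmin_l d0 PI). pose proof (Rmin_r d0 PI).
      split; [split; [apply Rmin_glb_lt; lra|lra]|lra]. }
    specialize (Hd y).
    rewrite Rminus_0_r, Rabs_pos_eq, (Hint y), Rminus_0_l, Rabs_Ropp in Hd by lra.
    specialize (Hd ltac:(lra)). pose proof (Rabs_pos_lt _ Hne). lra. }
  assert (Hshift : forall (k : nat) x, h (x + INR k * (2 * PI)) = h x).
  { induction k as [|k IH]; intros x.
    - simpl. f_equal. ring.
    - rewrite <- (IH x), <- (Hper (x + INR k * (2 * PI))). f_equal. rewrite S_INR. ring. }
  assert (Hpos : forall x, 0 <= x -> h x = 0).
  { intros x Hx.
    destruct (nfloor_ex (x / (2 * PI))) as (k & Hk1 & Hk2).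
    { apply Rdiv_le_0_compat; lra. }
    apply (Rmult_le_compat_r (2 * PI)) in Hk1; [|lra].
    apply (Rmult_lt_compat_r (2 * PI)) in Hk2; [|lra].
    unfold Rdiv in Hk1, Hk2. rewrite Rmult_assoc, Rinv_l, Rmult_1_r in Hk1, Hk2 by lra.
    replace x with ((x - INR k * (2 * PI)) + INR k * (2 * PI)) by ring.
    rewrite Hshift. set (z := x - INR k * (2 * PI)).
    destruct (Req_dec z 0) as [->|]; auto. apply Hint. unfold z in *. lra. }
  intros x. destruct (INR_unbounded (- x / (2 * PI))) as (k & Hk).
  rewrite <- (Hshift k). apply Hpos.
  apply (Rmult_lt_compat_r (2 * PI)) in Hk; [|lra].
  unfold Rdiv in Hk. rewrite Rmult_assoc, Rinv_l, Rmult_1_r in Hk by lra. lra.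
Qed.

(** * Orthogonality of the trigonometric functions *)

Lemma period_int_sum (f : nat -> R -> R) (c : nat -> R) (m : nat) :
  (forall i x, (i <= m)%nat -> continuous (f i) x) ->
  (forall x, continuous (fun x => sum_f_R0 (fun i => c i * f i x) m) x) /\
  period_int (fun x => sum_f_R0 (fun i => c i * f i x) m)
  = sum_f_R0 (fun i => c i * period_int (f i)) m.
Proof.
  induction m as [|m IH]; intros Hf; simpl.
  - split.
    + intros x. apply (continuous_Rmult (fun _ => c 0%nat)); [apply continuous_const|auto].
    + apply period_int_scal. auto.
  - destruct IH as [IHc IH]. { intros i x Hi. apply Hf. lia. }
    assert (Hl : forall x, continuous (f (S m)) x) by (intros; apply Hf; lia).
    split.
    + intros x. apply continuous_Rplus; auto.
      apply (continuous_Rmult (fun _ => c (S m))); [apply continuous_const|auto].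
    + rewrite <- IH.
      rewrite (period_int_ext _ (fun x => 1 * sum_f_R0 (fun i => c i * f i x) m
        + c (S m) * f (S m) x)) by (intros; ring).
      rewrite period_int_lin by auto. ring.
Qed.

Lemma sum_single (f : nat -> R) (m k : nat) : (k <= m)%nat ->
  (forall i, (i <= m)%nat -> i <> k -> f i = 0) -> sum_f_R0 f m = f k.
Proof.
  intros Hk Hf. destruct m as [|m].
  - now replace k with 0%nat by lia.
  - rewrite (sum_skip f k) by auto. rewrite (sum_eq _ (fun _ => 0)), sum_cte; [ring|].
    intros i Hi. unfold skip. destruct (Nat.ltb_spec i k); apply Hf; lia.
Qed.

(** Excludes the zero function sin (0 x) from the trigonometric system. *)
Definition genuine (c : bool) (n : nat) : Prop := n <> 0%nat \/ c = true.

(** For different frequencies, p'' = - n^2 p and q'' = - k^2 q make p q a multiple of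
    the derivative of the periodic function p' q - p q'. *)
Lemma trig_orthogonal (c d : bool) (n k : nat) : (c, n) <> (d, k) ->
  period_int (fun x => trig c n x * trig d k x) = 0.
Proof.
  intros Hne. destruct (Nat.eq_dec n k) as [->|Hnk].
  - destruct (Nat.eq_dec k 0) as [->|Hk].
    + apply period_int_0. intros x. destruct c, d; try congruence; unfold trig; simpl;
        rewrite Rmult_0_l, sin_0; ring.
    + assert (Hk' : INR k <> 0) by now apply not_0_INR.
      rewrite (period_int_ext _ (fun x => trig true k x * trig false k x))
        by (intros; destruct c, d; try congruence; ring).
      apply (period_int_derive (fun x => trig false k x * trig false k x / (2 * INR k))).
      * intros x. now rewrite periodic_trig.
      * intros x. unfold trig. auto_derive; auto. field; auto.
      * intros x. cont.
  - assert (Hd : INR k ^ 2 - INR n ^ 2 <> 0).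
    { assert (Hnk' : INR n <> INR k) by (now intro H; apply INR_eq in H).
      intro H.
      replace (INR k ^ 2 - INR n ^ 2) with ((INR k - INR n) * (INR k + INR n)) in H by ring.
      apply Rmult_integral in H. pose proof (pos_INR n). pose proof (pos_INR k).
      destruct H; lra. }
    apply (period_int_derive (fun x =>
      (dtrig c n x * trig d k x - trig c n x * dtrig d k x) / (INR k ^ 2 - INR n ^ 2))).
    + intros x. now rewrite !periodic_trig, !periodic_dtrig.
    + intros x. unfold trig, dtrig.
      destruct c, d; auto_derive; auto; field; simpl in Hd; now rewrite !Rmult_1_r in Hd.
    + intros x. cont.
Qed.

Lemma trig_norm_pos (c : bool) (n : nat) : genuine c n ->
  0 < period_int (fun x => trig c n x * trig c n x).
Proof.
  intros Hg. pose proof PI_RGT_0.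
  destruct (Nat.eq_dec n 0) as [->|Hn].
  - destruct Hg as [Hg|Hg]; [congruence|]. subst c.
    rewrite (period_int_ext _ (fun x => 1)).
    + unfold period_int. rewrite RInt_const. unfold scal; simpl; unfold mult; simpl. lra.
    + intros x. unfold trig. simpl. rewrite Rmult_0_l, cos_0. ring.
  - assert (Hn' : INR n <> 0) by now apply not_0_INR.
    assert (H0 : period_int (fun x => trig c n x * trig c n x - / 2) = 0).
    { apply (period_int_derive (fun x => (if c then 1 else -1) *
        (trig true n x * trig false n x) / (2 * INR n))).
      - intros x. now rewrite !periodic_trig.
      - intros x. unfold trig. destruct c; auto_derive; auto;
          pose proof (sin2_cos2 (INR n * x)) as Hsc; unfold Rsqr in Hsc.
        + replace (/ 2) with ((sin (INR n * x) * sin (INR n * x) +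
            cos (INR n * x) * cos (INR n * x)) * / 2) by (rewrite Hsc; lra). field; auto.
        + replace (/ 2) with ((sin (INR n * x) * sin (INR n * x) +
            cos (INR n * x) * cos (INR n * x)) * / 2) by (rewrite Hsc; lra). field; auto.
      - intros x. apply (continuous_Rplus (fun x => trig c n x * trig c n x)); cont. }
    rewrite (period_int_ext _ (fun x => 1 * (trig c n x * trig c n x) + (- / 2) * 1)) in H0
      by (intros; ring).
    rewrite (period_int_lin (fun x => trig c n x * trig c n x) (fun _ => 1)) in H0
      by cont.
    unfold period_int at 2 in H0. rewrite RInt_const in H0.
    unfold scal in H0; simpl in H0; unfold mult in H0; simpl in H0. lra.
Qed.

(** * Hyperbolic profiles and smoothness *)

(** The solutions of y'' = n^2 y with initial data (1, 0) and (0, 1), including n = 0. *)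
Definition hcos (n : nat) (t : R) : R := cosh (INR n * t).
Definition hsin (n : nat) (t : R) : R :=
  match n with O => t | _ => sinh (INR n * t) / INR n end.

Lemma is_derive_cosh x : is_derive cosh x (sinh x).
Proof. apply is_derive_Reals, derivable_pt_lim_cosh. Qed.
Lemma is_derive_sinh x : is_derive sinh x (cosh x).
Proof. apply is_derive_Reals, derivable_pt_lim_sinh. Qed.

Lemma is_derive_hcos n t : is_derive (hcos n) t (INR n ^ 2 * hsin n t).
Proof.
  unfold hcos.
  evar_last.
  - apply (is_derive_comp cosh (fun t => INR n * t)); [apply is_derive_cosh|].
    auto_derive; auto.
  - unfold scal; simpl; unfold mult; simpl.
    destruct n; [simpl; ring|]. unfold hsin. field. now apply not_0_INR.
Qed.

Lemma is_derive_hsin n t : is_derive (hsin n) t (hcos n t).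
Proof.
  destruct n as [|n].
  - unfold hsin, hcos. simpl INR. rewrite Rmult_0_l, cosh_0. apply (is_derive_id t).
  - assert (Hn : INR (S n) <> 0) by now apply not_0_INR.
    unfold hsin, hcos. generalize dependent (INR (S n)). intros N Hn. evar_last.
    + apply (is_derive_ext (fun t => / N * sinh (N * t))).
      { intros s. simpl. unfold Rdiv. apply Rmult_comm. }
      apply (is_derive_scal (fun t => sinh (N * t))).
      apply (is_derive_comp sinh (fun t => N * t)); [apply is_derive_sinh|].
      auto_derive; auto.
    + unfold scal; simpl; unfold mult; simpl. field. exact Hn.
Qed.

Lemma cosh_sinh x : cosh x ^ 2 = 1 + sinh x ^ 2.
Proof.
  unfold cosh, sinh.
  assert (exp x * exp (- x) = 1) by (rewrite <- exp_plus, Rplus_opp_r; apply exp_0). nra.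
Qed.

Lemma hcos_hsin n t : hcos n t ^ 2 = 1 + INR n ^ 2 * hsin n t ^ 2.
Proof.
  unfold hcos, hsin. rewrite cosh_sinh. destruct n; [simpl INR; rewrite Rmult_0_l, sinh_0; ring|].
  field. now apply not_0_INR.
Qed.

Lemma hcos_0 n : hcos n 0 = 1.
Proof. unfold hcos. now rewrite Rmult_0_r, cosh_0. Qed.
Lemma hsin_0 n : hsin n 0 = 0.
Proof.
  unfold hsin. destruct n; auto. rewrite Rmult_0_r, sinh_0. unfold Rdiv; ring.
Qed.

Lemma cosh_gt_0 x : 0 < cosh x.
Proof. unfold cosh. pose proof (exp_pos x). pose proof (exp_pos (- x)). lra. Qed.

Lemma sinh_pos x : 0 < x -> 0 < sinh x.
Proof.
  intros Hx. unfold sinh. assert (exp (- x) < exp x) by (apply exp_increasing; lra). lra.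
Qed.

Lemma hsin_pos n t : 0 < t -> 0 < hsin n t.
Proof.
  intros Ht. unfold hsin. destruct n; auto.
  assert (0 < INR (S n)) by (apply lt_0_INR; lia).
  apply Rdiv_lt_0_compat; auto. apply sinh_pos. now apply Rmult_lt_0_compat.
Qed.

Lemma hcos_pos n t : 0 < hcos n t.
Proof. apply cosh_gt_0. Qed.

(** Smoothness comes for free in a class of functions that differentiation does not
    leave. *)
Lemma smooth_class (C : (R -> R) -> Prop) :
  (forall p, C p -> exists q, C q /\ forall x, is_derive p x (q x)) ->
  forall p, C p -> smooth p.
Proof.
  intros HC p Hp.
  assert (H : forall n, C (Derive_n p n)).
  { induction n as [|n IH]; simpl; auto.
    destruct (HC _ IH) as (q & Hq & Hd).
    replace (Derive (Derive_n p n)) with q; auto.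
    apply functional_extensionality. intros x. symmetry. now apply is_derive_unique. }
  intros [|n] x; simpl; auto.
  destruct (HC _ (H n)) as (q & _ & Hd). now exists (q x).
Qed.

Lemma smooth_second_order (p q : R -> R) (k : R) :
  (forall x, is_derive p x (q x)) -> (forall x, is_derive q x (k * p x)) -> smooth p.
Proof.
  intros Hp Hq.
  apply (smooth_class (fun r => exists al be, r = fun x => al * p x + be * q x)).
  - intros r (al & be & ->). exists (fun x => al * q x + be * (k * p x)). split.
    + exists (be * k), al. apply functional_extensionality. intros x. ring.
    + intros x.
      apply (is_derive_plus (fun x => al * p x) (fun x => be * q x) x
        (al * q x) (be * (k * p x))); now apply is_derive_scal.
  - exists 1, 0. apply functional_extensionality. intros x. ring.
Qed.

Lemma smooth_Derive p : smooth p -> smooth (Derive p).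
Proof.
  intros Hp n x. destruct n as [|n]; [exact I|].
  assert (H : forall m y, Derive_n (Derive p) m y = Derive_n p (S m) y).
  { intros m y. change (Derive p) with (Derive_n p 1).
    rewrite Derive_n_comp. f_equal. lia. }
  apply (ex_derive_ext (Derive_n p (S n))).
  - intros y. now rewrite H.
  - apply (Hp (S (S n)) x).
Qed.

Lemma smooth_ex_derive p x : smooth p -> ex_derive p x.
Proof. intros Hp. apply (Hp 1%nat x). Qed.

Lemma smooth_continuous p x : smooth p -> continuous p x.
Proof. intros Hp. now apply (ex_derive_continuous p), smooth_ex_derive. Qed.

Lemma smooth2_product p q : smooth p -> smooth q -> smooth2 (fun t th => p t * q th).
Proof.
  intros Hp Hq n. revert p q Hp Hq.
  assert (Hc : forall p q, smooth p -> smooth q -> forall x y,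
    continuity_2d_pt (fun t th => p t * q th) x y).
  { intros p q Hp Hq x y. apply continuity_2d_pt_mult.
    - apply continuity_1d_2d_pt_comp; [|apply continuity_2d_pt_id1].
      now apply continuity_pt_filterlim, smooth_continuous.
    - apply (continuity_1d_2d_pt_comp q (fun _ v => v)); [|apply continuity_2d_pt_id2].
      now apply continuity_pt_filterlim, smooth_continuous. }
  induction n as [|n IH]; intros p q Hp Hq x y; simpl; split; auto.
  repeat split.
  - apply (ex_derive_mult p (fun _ => q y)); [now apply smooth_ex_derive|apply ex_derive_const].
  - apply (ex_derive_mult (fun _ => p x) q); [apply ex_derive_const|now apply smooth_ex_derive].
  - replace (fun u v : R => Derive (fun z => p z * q v) u) with (fun u v => Derive p u * q v).
    + apply IH; auto. now apply smooth_Derive.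
    + apply functional_extensionality; intros u. apply functional_extensionality; intros v.
      now rewrite Derive_scal_l.
  - replace (fun u v : R => Derive (fun z => p u * q z) v) with (fun u v => p u * Derive q v).
    + apply IH; auto. now apply smooth_Derive.
    + apply functional_extensionality; intros u. apply functional_extensionality; intros v.
      now rewrite Derive_scal.
Qed.

Lemma smooth_trig c n : smooth (trig c n).
Proof.
  apply (smooth_second_order _ (dtrig c n) (- INR n ^ 2));
    [apply is_derive_trig|apply is_derive_dtrig].
Qed.

Lemma smooth_scal k p : smooth p -> smooth (fun x => k * p x).
Proof.
  intros Hp n x. destruct n as [|n]; [exact I|].
  apply (ex_derive_ext (fun x => k * Derive_n p n x)).
  - intros y. now rewrite Derive_n_scal_l.
  - apply (ex_derive_scal (Derive_n p n)). apply (Hp (S n) x).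
Qed.

(** * Fourier modes of a harmonic function on the cylinder *)

Lemma smooth2_d_t u : smooth2 u -> smooth2 (d_t u).
Proof. intros Hu n x y. destruct (Hu (S n) x y) as (_ & _ & _ & H & _). exact H. Qed.
Lemma smooth2_d_th u : smooth2 u -> smooth2 (d_th u).
Proof. intros Hu n x y. destruct (Hu (S n) x y) as (_ & _ & _ & _ & H). exact H. Qed.

Lemma smooth2_is_derive_t u t th : smooth2 u -> is_derive (fun s => u s th) t (d_t u t th).
Proof. intros Hu. destruct (Hu 1%nat t th) as (_ & H & _). now apply Derive_correct. Qed.
Lemma smooth2_is_derive_th u t th : smooth2 u -> is_derive (u t) th (d_th u t th).
Proof. intros Hu. destruct (Hu 1%nat t th) as (_ & _ & H & _). now apply Derive_correct. Qed.

Lemma smooth2_continuous_2d u t th : smooth2 u -> continuity_2d_pt u t th.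
Proof. intros Hu. exact (proj1 (Hu 0%nat t th)). Qed.
Lemma smooth2_continuous u t th : smooth2 u -> continuous (u t) th.
Proof. intros Hu. eapply continuous_of_derive. now apply smooth2_is_derive_th. Qed.

Definition fourier (c : bool) (n : nat) (u : R -> R -> R) (t : R) : R :=
  period_int (fun th => u t th * trig c n th).

Lemma is_derive_fourier c n u t : smooth2 u ->
  is_derive (fourier c n u) t (fourier c n (d_t u) t).
Proof.
  intros Hu.
  assert (Hd : forall s th, is_derive (fun z => u z th * trig c n th) s
    (d_t u s th * trig c n th)).
  { intros s th.
    apply (is_derive_ext (fun z => trig c n th * u z th)); [intros; simpl; ring|].
    rewrite Rmult_comm. apply is_derive_scal. now apply smooth2_is_derive_t. }
  unfold fourier, period_int.
  rewrite (RInt_ext (fun th => d_t u t th * trig c n th)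
    (fun th => Derive (fun s => u s th * trig c n th) t)).
  2:{ intros th _. symmetry. now apply is_derive_unique. }
  apply (is_derive_RInt_param (fun s th => u s th * trig c n th)).
  - apply filter_forall. intros s th _. eexists. apply Hd.
  - intros th _.
    apply (continuity_2d_pt_ext (fun s th => d_t u s th * trig c n th)).
    { intros s w. symmetry. now apply is_derive_unique. }
    apply continuity_2d_pt_mult.
    + now apply smooth2_continuous_2d, smooth2_d_t.
    + apply (continuity_1d_2d_pt_comp (trig c n) (fun _ v => v)); [|apply continuity_2d_pt_id2].
      apply continuity_pt_filterlim, continuous_trig.
  - apply filter_forall. intros s. apply ex_RInt_cont. intros th.
    apply continuous_Rmult; [now apply smooth2_continuous|apply continuous_trig].
Qed.

Lemma periodic_d_th u t : smooth2 u -> periodic (u t) -> periodic (d_th u t).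
Proof.
  intros Hu Hp th. unfold d_th.
  transitivity (Derive (fun w => u t (w + 2 * PI)) th); [symmetry|now apply Derive_ext].
  rewrite (Derive_comp (u t) (fun w => w + 2 * PI)).
  - assert (H1 : Derive (fun w => w + 2 * PI) th = 1)
      by (apply is_derive_unique; auto_derive; auto).
    rewrite H1. apply Rmult_1_l.
  - eexists. now apply smooth2_is_derive_th.
  - auto_derive; auto.
Qed.

(** Two integrations by parts at once: u_thth e + n^2 u e is the th-derivative of the
    periodic function u_th e - u e', where e = [trig c n]. *)
Lemma fourier_d_th_d_th c n u t : smooth2 u -> periodic (u t) ->
  fourier c n (d_th (d_th u)) t = - INR n ^ 2 * fourier c n u t.
Proof.
  intros Hu Hp.
  pose proof (smooth2_d_th u Hu) as Hu1. pose proof (smooth2_d_th _ Hu1) as Hu2.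
  assert (C0 : forall x, continuous (fun th => u t th * trig c n th) x).
  { intros x. apply continuous_Rmult; [now apply smooth2_continuous|apply continuous_trig]. }
  assert (C2 : forall x, continuous (fun th => d_th (d_th u) t th * trig c n th) x).
  { intros x. apply continuous_Rmult; [now apply smooth2_continuous|apply continuous_trig]. }
  assert (H : period_int (fun th => 1 * (d_th (d_th u) t th * trig c n th)
    + INR n ^ 2 * (u t th * trig c n th)) = 0).
  { apply (period_int_derive (fun th => d_th u t th * trig c n th - u t th * dtrig c n th)).
    - intros th. now rewrite Hp, periodic_d_th, periodic_trig, periodic_dtrig.
    - intros th.
      replace (1 * (d_th (d_th u) t th * trig c n th) + INR n ^ 2 * (u t th * trig c n th))
        with ((d_th (d_th u) t th * trig c n th + d_th u t th * dtrig c n th)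
          - (d_th u t th * dtrig c n th + u t th * (- INR n ^ 2 * trig c n th))) by ring.
      apply (is_derive_minus (fun th => d_th u t th * trig c n th)
        (fun th => u t th * dtrig c n th)).
      + apply (is_derive_mult (d_th u t) (trig c n)).
        * now apply smooth2_is_derive_th.
        * apply is_derive_trig.
        * intros; apply Rmult_comm.
      + apply (is_derive_mult (u t) (dtrig c n)).
        * now apply smooth2_is_derive_th.
        * apply is_derive_dtrig.
        * intros; apply Rmult_comm.
    - intros x. apply continuous_Rplus; apply continuous_Rmult; auto; apply continuous_const. }
  rewrite period_int_lin in H by auto. unfold fourier. lra.
Qed.

Lemma constant_of_zero_derive (f df : R -> R) (T : R) : 0 < T ->
  (forall t, is_derive f t (df t)) -> (forall t, 0 < t < T -> df t = 0) -> f T = f 0.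
Proof.
  intros HT Hd Hz.
  destruct (MVT_gen f 0 T (fun _ => 0)) as (c & _ & Hc).
  - intros t Ht. rewrite Rmin_left, Rmax_right in Ht by lra.
    rewrite <- (Hz t Ht). apply Hd.
  - intros t _. apply continuity_pt_filterlim. eapply continuous_of_derive. apply Hd.
  - lra.
Qed.

Lemma is_derive_reflect (f df : R -> R) (T t : R) :
  (forall s, is_derive f s (df s)) -> is_derive (fun s => f (T - s)) t (- df (T - t)).
Proof.
  intros Hf. replace (- df (T - t)) with (scal (-1) (df (T - t)))
    by (unfold scal; simpl; unfold mult; simpl; ring).
  apply (is_derive_comp f (fun s => T - s)); auto. auto_derive; auto.
Qed.

Lemma is_derive_Rmult (f g : R -> R) (x df dg : R) :
  is_derive f x df -> is_derive g x dg ->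
  is_derive (fun x => f x * g x) x (df * g x + f x * dg).
Proof. intros Hf Hg. apply (is_derive_mult f g); auto. intros; apply Rmult_comm. Qed.

Lemma is_derive_Rplus (f g : R -> R) (x df dg : R) :
  is_derive f x df -> is_derive g x dg -> is_derive (fun x => f x + g x) x (df + dg).
Proof. apply (is_derive_plus f g). Qed.

(** Uniqueness for A'' = n^2 A on (0, T): both A(t) K(T - t) + A'(t) S(T - t) and its
    companion n^2 A(t) S(T - t) + A'(t) K(T - t), with K = [hcos n] and S = [hsin n], are
    constant; compare t = 0 and t = T. *)
Lemma oscillator_transport (n : nat) (A A1 A2 : R -> R) (T : R) : 0 < T ->
  (forall t, is_derive A t (A1 t)) -> (forall t, is_derive A1 t (A2 t)) ->
  (forall t, 0 < t < T -> A2 t = INR n ^ 2 * A t) ->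
  A T = hcos n T * A 0 + hsin n T * A1 0 /\
  A1 T = INR n ^ 2 * hsin n T * A 0 + hcos n T * A1 0.
Proof.
  intros HT HA HA1 HA2.
  assert (HK := fun t => is_derive_reflect _ _ T t (is_derive_hcos n)).
  assert (HS := fun t => is_derive_reflect _ _ T t (is_derive_hsin n)).
  cbv beta in HK, HS. split.
  - assert (E : A T * hcos n (T - T) + A1 T * hsin n (T - T)
      = A 0 * hcos n (T - 0) + A1 0 * hsin n (T - 0)).
    { apply (constant_of_zero_derive (fun t => A t * hcos n (T - t) + A1 t * hsin n (T - t))
        (fun t => (A1 t * hcos n (T - t) + A t * - (INR n ^ 2 * hsin n (T - t)))
          + (A2 t * hsin n (T - t) + A1 t * - hcos n (T - t)))); auto.
      - intros t. apply (is_derive_Rplus (fun t => A t * hcos n (T - t))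
          (fun t => A1 t * hsin n (T - t))).
        + apply (is_derive_Rmult A (fun t => hcos n (T - t))); auto.
        + apply (is_derive_Rmult A1 (fun t => hsin n (T - t))); auto.
      - intros t Ht. rewrite HA2 by auto. ring. }
    rewrite Rminus_diag, Rminus_0_r, hcos_0, hsin_0 in E. lra.
  - assert (E : (INR n ^ 2 * A T) * hsin n (T - T) + A1 T * hcos n (T - T)
      = (INR n ^ 2 * A 0) * hsin n (T - 0) + A1 0 * hcos n (T - 0)).
    { apply (constant_of_zero_derive
        (fun t => (INR n ^ 2 * A t) * hsin n (T - t) + A1 t * hcos n (T - t))
        (fun t => ((INR n ^ 2 * A1 t) * hsin n (T - t) + (INR n ^ 2 * A t) * - hcos n (T - t))
          + (A2 t * hcos n (T - t) + A1 t * - (INR n ^ 2 * hsin n (T - t))))); auto.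
      - intros t. apply (is_derive_Rplus (fun t => INR n ^ 2 * A t * hsin n (T - t))
          (fun t => A1 t * hcos n (T - t))).
        + apply (is_derive_Rmult (fun t => INR n ^ 2 * A t) (fun t => hsin n (T - t))); auto.
          now apply is_derive_scal.
        + apply (is_derive_Rmult A1 (fun t => hcos n (T - t))); auto.
      - intros t Ht. rewrite HA2 by auto. ring. }
    rewrite Rminus_diag, Rminus_0_r, hcos_0, hsin_0 in E. lra.
Qed.

(** * The Steklov problem of a conformal metric *)

(** The eigenvalue problem after removing the conformal factor, of which only the
    boundary values [a] and [b] are left. *)
Definition conformal_steklov (a b T lam : R) (phi : boundary_fun) (u : R -> R -> R) : Prop :=
  smooth2 u /\ (forall t, periodic (u t))
  /\ (forall t th, 0 < t < T -> d_t (d_t u) t th + d_th (d_th u) t th = 0)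
  /\ (forall s th, u (side_pos T s) th = phi s th)
  /\ (forall th, d_t u 0 th = - (lam * a) * phi Left th)
  /\ (forall th, d_t u T th = lam * b * phi Right th).

(** Its roots are the eigenvalues carried by frequency [n]: the boundary conditions at
    0 fix the profile [hcos n - lam a hsin n], and [charpoly] is what remains of
    the boundary condition at [T]. *)
Definition charpoly (a b T : R) (n : nat) (x : R) : R :=
  hsin n T * (a * b) * x ^ 2 - hcos n T * (a + b) * x + INR n ^ 2 * hsin n T.

Definition boundary_fourier (c : bool) (n : nat) (phi : boundary_fun) (s : side) : R :=
  period_int (fun th => phi s th * trig c n th).

(** One real number, the coefficient on the left circle, controls the mode of an
    eigenfunction, and it is nonzero only at the roots of [charpoly]. *)
Lemma boundary_fourier_eigen (a b T lam : R) (phi : boundary_fun) u c n : 0 < T ->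
  conformal_steklov a b T lam phi u ->
  boundary_fourier c n phi Right
    = (hcos n T - lam * a * hsin n T) * boundary_fourier c n phi Left
  /\ (charpoly a b T n lam <> 0 -> boundary_fourier c n phi Left = 0).
Proof.
  intros HT (Hu & Hp & Hlap & Hphi & H0 & H1).
  pose proof (smooth2_d_t u Hu) as Hut. pose proof (smooth2_d_t _ Hut) as Hutt.
  assert (Hcont : forall s x, continuous (fun th => phi s th * trig c n th) x).
  { intros s x. apply continuous_Rmult; [|apply continuous_trig].
    apply (continuous_ext (u (side_pos T s))); [apply Hphi|].
    now apply smooth2_continuous. }
  assert (Hscal : forall k s, period_int (fun th => k * phi s th * trig c n th)
      = k * boundary_fourier c n phi s).
  { intros k s. unfold boundary_fourier. rewrite <- period_int_scal by auto.
    apply period_int_ext. intros; ring. }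
  destruct (oscillator_transport n (fourier c n u) (fourier c n (d_t u))
    (fourier c n (d_t (d_t u))) T HT) as [E1 E2].
  - intros t. now apply is_derive_fourier.
  - intros t. now apply is_derive_fourier.
  - intros t Ht.
    pose proof (fourier_d_th_d_th c n u t Hu (Hp t)) as E. unfold fourier in *.
    rewrite (period_int_ext _ (fun th => -1 * (d_th (d_th u) t th * trig c n th))).
    + rewrite period_int_scal, E; [ring|].
      intros x. apply continuous_Rmult; [|apply continuous_trig].
      now apply smooth2_continuous, smooth2_d_th, smooth2_d_th.
    + intros th. specialize (Hlap t th Ht).
      replace (d_t (d_t u) t th) with (- d_th (d_th u) t th) by lra. ring.
  - assert (F0 : fourier c n u 0 = boundary_fourier c n phi Left).
    { apply period_int_ext. intros th. now rewrite <- Hphi. }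
    assert (FT : fourier c n u T = boundary_fourier c n phi Right).
    { apply period_int_ext. intros th. now rewrite <- Hphi. }
    assert (G0 : fourier c n (d_t u) 0 = - (lam * a) * boundary_fourier c n phi Left).
    { rewrite <- Hscal. apply period_int_ext. intros th. now rewrite H0. }
    assert (GT : fourier c n (d_t u) T = lam * b * boundary_fourier c n phi Right).
    { rewrite <- Hscal. apply period_int_ext. intros th. now rewrite H1. }
    rewrite F0, G0, FT in E1. rewrite F0, G0, GT in E2. split; [lra|].
    intros Hne. rewrite E1 in E2.
    assert (E : charpoly a b T n lam * boundary_fourier c n phi Left = 0).
    { unfold charpoly. lra. }
    apply Rmult_integral in E. tauto.
Qed.

Definition mode_fun (a T lam : R) (c : bool) (n : nat) : boundary_fun := fun s th =>
  (hcos n (side_pos T s) - lam * a * hsin n (side_pos T s)) * trig c n th.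

Lemma smooth_profile k n : smooth (fun t => hcos n t - k * hsin n t).
Proof.
  apply (smooth_second_order _ (fun t => INR n ^ 2 * hsin n t - k * hcos n t) (INR n ^ 2)).
  - intros t. apply (is_derive_minus (hcos n) (fun t => k * hsin n t)).
    + apply is_derive_hcos.
    + apply is_derive_scal, is_derive_hsin.
  - intros t.
    replace (INR n ^ 2 * (hcos n t - k * hsin n t))
      with (INR n ^ 2 * hcos n t - k * (INR n ^ 2 * hsin n t)) by ring.
    apply (is_derive_minus (fun t => INR n ^ 2 * hsin n t) (fun t => k * hcos n t)).
    + apply is_derive_scal, is_derive_hsin.
    + apply is_derive_scal, is_derive_hcos.
Qed.

Lemma mode_fun_conformal (a b T lam : R) c n : charpoly a b T n lam = 0 ->
  conformal_steklov a b T lam (mode_fun a T lam c n)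
    (fun t th => (hcos n t - lam * a * hsin n t) * trig c n th).
Proof.
  intros Hq. set (k := lam * a).
  assert (D1 : forall t, is_derive (fun t => hcos n t - k * hsin n t) t
    (INR n ^ 2 * hsin n t - k * hcos n t)).
  { intros t. apply (is_derive_minus (hcos n) (fun t => k * hsin n t)).
    - apply is_derive_hcos.
    - apply is_derive_scal, is_derive_hsin. }
  assert (D2 : forall t, is_derive (fun t => INR n ^ 2 * hsin n t - k * hcos n t) t
    (INR n ^ 2 * hcos n t - k * (INR n ^ 2 * hsin n t))).
  { intros t. apply (is_derive_minus (fun t => INR n ^ 2 * hsin n t) (fun t => k * hcos n t)).
    - apply is_derive_scal, is_derive_hsin.
    - apply is_derive_scal, is_derive_hcos. }
  assert (Dt : forall w dw, (forall t, is_derive w t (dw t)) ->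
    d_t (fun t th => w t * trig c n th) = fun t th => dw t * trig c n th).
  { intros w dw Hw. apply functional_extensionality; intros t.
    apply functional_extensionality; intros th. unfold d_t.
    rewrite Derive_scal_l. f_equal. now apply is_derive_unique. }
  assert (Dth : forall w (p dp : R -> R), (forall t, is_derive p t (dp t)) ->
    d_th (fun t th => w t * p th) = fun t th => w t * dp th).
  { intros w p dp Hp'. apply functional_extensionality; intros t.
    apply functional_extensionality; intros th. unfold d_th.
    rewrite Derive_scal. f_equal. now apply is_derive_unique. }
  split; [|split; [|split; [|split; [|split]]]].
  - apply smooth2_product; [apply smooth_profile|apply smooth_trig].
  - intros t th. now rewrite periodic_trig.
  - intros t th _. rewrite (Dt _ _ D1), (Dt _ _ D2).
    rewrite (Dth _ _ _ (is_derive_trig c n)), (Dth _ _ _ (is_derive_dtrig c n)). ring.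
  - reflexivity.
  - intros th. rewrite (Dt _ _ D1). unfold mode_fun, side_pos.
    rewrite hcos_0, hsin_0. unfold k. ring.
  - intros th. rewrite (Dt _ _ D1). unfold mode_fun, side_pos.
    unfold charpoly in Hq. unfold k.
    replace (INR n ^ 2 * hsin n T - lam * a * hcos n T)
      with (lam * b * (hcos n T - lam * a * hsin n T)) by lra. ring.
Qed.

(** * The eigenvalues of the modes *)

Definition root_gap (a b T : R) (n : nat) : R :=
  sqrt (hcos n T ^ 2 * (a + b) ^ 2 - 4 * (a * b) * (INR n ^ 2 * hsin n T ^ 2)).

Definition eig (a b T : R) (n : nat) (up : bool) : R :=
  (hcos n T * (a + b) + (if up then root_gap a b T n else - root_gap a b T n))
  / (2 * (a * b) * hsin n T).

(** The radicand equals (a + b)^2 + (n S (a - b))^2, so that the roots are distinct. *)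
Lemma root_gap_spec a b T n : 0 < a -> 0 < b ->
  0 < root_gap a b T n /\ root_gap a b T n ^ 2 =
    hcos n T ^ 2 * (a + b) ^ 2 - 4 * (a * b) * (INR n ^ 2 * hsin n T ^ 2).
Proof.
  intros Ha Hb. unfold root_gap.
  assert (H : 0 < hcos n T ^ 2 * (a + b) ^ 2 - 4 * (a * b) * (INR n ^ 2 * hsin n T ^ 2)).
  { rewrite hcos_hsin.
    replace ((1 + INR n ^ 2 * hsin n T ^ 2) * (a + b) ^ 2
      - 4 * (a * b) * (INR n ^ 2 * hsin n T ^ 2))
      with ((a + b) ^ 2 + (INR n * hsin n T * (a - b)) ^ 2) by ring.
    pose proof (pow2_ge_0 (INR n * hsin n T * (a - b))).
    assert (0 < (a + b) ^ 2) by (apply pow_lt; lra). lra. }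
  split; [now apply sqrt_lt_R0|]. rewrite pow2_sqrt; lra.
Qed.

Lemma charpoly_factor a b T n x : 0 < a -> 0 < b -> 0 < T ->
  charpoly a b T n x =
  hsin n T * (a * b) * (x - eig a b T n false) * (x - eig a b T n true).
Proof.
  intros Ha Hb HT. destruct (root_gap_spec a b T n Ha Hb) as [_ Hg].
  pose proof (hsin_pos n T HT). unfold charpoly, eig.
  set (g := root_gap a b T n) in *.
  transitivity (((2 * (a * b) * hsin n T * x - hcos n T * (a + b)) ^ 2 - g ^ 2)
    / (4 * (a * b) * hsin n T)).
  - rewrite Hg. field. repeat split; lra.
  - field. repeat split; lra.
Qed.

Lemma charpoly_root a b T n x : 0 < a -> 0 < b -> 0 < T ->
  charpoly a b T n x = 0 <-> exists up, x = eig a b T n up.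
Proof.
  intros Ha Hb HT. rewrite charpoly_factor by auto.
  pose proof (hsin_pos n T HT). pose proof (Rmult_lt_0_compat a b Ha Hb). split.
  - intros H1. apply Rmult_integral in H1 as [H1|H1].
    + exists false. apply Rmult_integral in H1 as [H1|H1]; [|lra].
      apply Rmult_integral in H1; lra.
    + exists true. lra.
  - intros (up & ->). destruct up; ring.
Qed.

Lemma eig_lt a b T n : 0 < a -> 0 < b -> 0 < T ->
  eig a b T n false < eig a b T n true.
Proof.
  intros Ha Hb HT. destruct (root_gap_spec a b T n Ha Hb) as [Hg _].
  pose proof (hsin_pos n T HT). pose proof (Rmult_lt_0_compat a b Ha Hb).
  apply Rmult_lt_compat_r; [|lra].
  apply Rinv_0_lt_compat. apply Rmult_lt_0_compat; lra.
Qed.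

Lemma eig_nonneg a b T n up : 0 < a -> 0 < b -> 0 < T -> 0 <= eig a b T n up.
Proof.
  intros Ha Hb HT. destruct (root_gap_spec a b T n Ha Hb) as [Hg Hg2].
  pose proof (hsin_pos n T HT). pose proof (Rmult_lt_0_compat a b Ha Hb).
  pose proof (hcos_pos n T).
  assert (Hle : root_gap a b T n <= hcos n T * (a + b)).
  { apply Rsqr_incr_0_var; [|apply Rmult_le_pos; lra]. unfold Rsqr.
    pose proof (pow2_ge_0 (INR n * hsin n T)). nra. }
  apply Rdiv_le_0_compat.
  - destruct up; lra.
  - apply Rmult_lt_0_compat; lra.
Qed.

(** The modes are numbered by j, where j + 2 = 4 n + 2 [cosine] + [upper root]; the shift
    by 2 leaves out exactly the two sine modes of frequency 0. *)
Definition freq (j : nat) : nat := ((j + 2) / 4)%nat.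
Definition is_cos (j : nat) : bool := (2 <=? (j + 2) mod 4)%nat.
Definition is_up (j : nat) : bool := Nat.odd j.

Definition mode_eig (a b T : R) (j : nat) : R := eig a b T (freq j) (is_up j).

Definition mode_index (n : nat) (c up : bool) : nat :=
  (4 * n + (if c then 2 else 0) + (if up then 1 else 0) - 2)%nat.

Lemma mode_index_spec n c up : genuine c n ->
  freq (mode_index n c up) = n /\ is_cos (mode_index n c up) = c /\ is_up (mode_index n c up) = up.
Proof.
  intros Hg.
  set (r := ((if c then 2 else 0) + (if up then 1 else 0))%nat).
  assert (Hr : (r < 4)%nat) by (unfold r; destruct c, up; simpl; lia).
  assert (H2 : (mode_index n c up + 2 = n * 4 + r)%nat).
  { unfold mode_index, r. destruct Hg as [Hg| ->]; destruct up; try destruct c; lia. }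
  assert (Hm : ((mode_index n c up + 2) mod 4 = r)%nat).
  { rewrite H2, Nat.add_comm, Nat.Div0.mod_add. now apply Nat.mod_small. }
  split; [|split].
  - unfold freq. rewrite H2, Nat.div_add_l, Nat.div_small by lia. lia.
  - unfold is_cos. rewrite Hm. unfold r. now destruct c, up.
  - unfold is_up. replace (Nat.odd (mode_index n c up)) with (Nat.odd (mode_index n c up + 2)).
    + rewrite H2, Nat.odd_add, Nat.odd_mul. simpl (Nat.odd 4).
      rewrite Bool.andb_false_r. unfold r. now destruct c, up.
    + rewrite Nat.odd_add. simpl (Nat.odd 2). now rewrite Bool.xorb_false_r.
Qed.

Lemma mode_index_surj j : j = mode_index (freq j) (is_cos j) (is_up j).
Proof.
  pose proof (Nat.div_mod_eq (j + 2) 4) as Hd.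
  pose proof (Nat.mod_upper_bound (j + 2) 4 ltac:(lia)) as Hm.
  assert (Hodd : is_up j = Nat.odd ((j + 2) mod 4)).
  { unfold is_up. transitivity (Nat.odd (j + 2)).
    - rewrite Nat.odd_add. simpl (Nat.odd 2). now rewrite Bool.xorb_false_r.
    - rewrite Hd at 1. rewrite Nat.odd_add, Nat.odd_mul. simpl (Nat.odd 4).
      now rewrite Bool.andb_false_l, Bool.xorb_false_l. }
  rewrite Hodd. unfold mode_index, freq, is_cos.
  set (q := ((j + 2) / 4)%nat) in *. set (r := ((j + 2) mod 4)%nat) in *.
  clearbody q r. clear Hodd.
  destruct r as [|[|[|[|]]]]; simpl; lia.
Qed.

Lemma genuine_mode j : genuine (is_cos j) (freq j).
Proof.
  unfold genuine. destruct (Nat.eq_dec (freq j) 0) as [H|H]; [right|now left].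
  unfold freq, is_cos in *. pose proof (Nat.div_mod_eq (j + 2) 4).
  apply Nat.leb_le. lia.
Qed.

Lemma hsin_ge_sinh n T : 0 < T -> n <> 0%nat -> sinh T <= hsin n T.
Proof.
  intros HT Hn.
  assert (H : forall m, INR m * sinh T <= sinh (INR m * T) /\ 1 <= cosh (INR m * T)).
  { assert (Hs : 0 < sinh T) by now apply sinh_pos.
    assert (Hc : 1 <= cosh T).
    { pose proof (hcos_hsin 1 T) as E. unfold hcos in E. simpl INR in E.
      rewrite Rmult_1_l in E. pose proof (cosh_gt_0 T). pose proof (pow2_ge_0 (hsin 1 T)). nra. }
    induction m as [|m [IHs IHc]].
    - simpl INR. rewrite !Rmult_0_l, sinh_0, cosh_0. lra.
    - rewrite S_INR, !Rmult_plus_distr_r, !Rmult_1_l.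
      assert (Ea : sinh (INR m * T + T) = sinh (INR m * T) * cosh T + cosh (INR m * T) * sinh T).
      { unfold sinh, cosh. rewrite Ropp_plus_distr, !exp_plus. field. }
      assert (Eb : cosh (INR m * T + T) = cosh (INR m * T) * cosh T + sinh (INR m * T) * sinh T).
      { unfold sinh, cosh. rewrite Ropp_plus_distr, !exp_plus. field. }
      pose proof (pos_INR m). assert (0 <= INR m * sinh T) by (apply Rmult_le_pos; lra).
      rewrite Ea, Eb. split; nra. }
  destruct n as [|n]; [congruence|]. unfold hsin.
  assert (0 < INR (S n)) by (apply lt_0_INR; lia).
  apply (Rmult_le_reg_l (INR (S n))); auto.
  replace (INR (S n) * (sinh (INR (S n) * T) / INR (S n))) with (sinh (INR (S n) * T))
    by (field; lra).
  apply H.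
Qed.

(** A root x <= B of frequency n >= 1 satisfies n^2 S <= B (a + b) K by [charpoly], while
    K <= 1 + n S and S >= sinh T; this bounds n. *)
Lemma mode_eig_tends_to_infinity a b T : 0 < a -> 0 < b -> 0 < T ->
  tends_to_infinity (mode_eig a b T).
Proof.
  intros Ha Hb HT B.
  set (D := Rmax B 0 * (a + b) * (/ sinh T + 1)).
  destruct (INR_unbounded (Rmax 1 D)) as (N & HN).
  exists (4 * (N + 1))%nat. intros j Hj.
  assert (Hfreq : (freq j <= N)%nat).
  2:{ unfold freq in Hfreq. pose proof (Nat.div_mod_eq (j + 2) 4).
      pose proof (Nat.mod_upper_bound (j + 2) 4 ltac:(lia)). lia. }
  destruct (Nat.eq_dec (freq j) 0) as [H0|H0]; [lia|].
  apply INR_le. apply Rle_trans with D; [|pose proof (Rmax_r 1 D); lra].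
  unfold mode_eig in Hj. set (n := freq j) in *. set (x := eig a b T n (is_up j)) in *.
  assert (Hx0 : 0 <= x) by now apply eig_nonneg.
  assert (Hq : charpoly a b T n x = 0) by (apply charpoly_root; auto; now exists (is_up j)).
  assert (Hxm : x <= Rmax B 0) by (apply Rle_trans with B; [auto|apply Rmax_l]).
  pose proof (sinh_pos T HT) as Hs1. pose proof (hsin_ge_sinh n T HT H0) as HsS.
  pose proof (hcos_hsin n T) as HK. pose proof (hcos_pos n T).
  assert (Hn1 : 1 <= INR n) by (apply (le_INR 1); lia).
  unfold charpoly in Hq. unfold D.
  set (K := hcos n T) in *. set (s := hsin n T) in *. set (X := Rmax B 0) in *.
  set (m := INR n) in *.
  assert (HK2 : K <= 1 + m * s).
  { apply Rsqr_incr_0_var; [unfold Rsqr|]; nra. }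
  assert (H1 : m ^ 2 * s <= X * (a + b) * (1 + m * s)).
  { assert (0 <= s * (a * b) * x ^ 2).
    { apply Rmult_le_pos; [repeat apply Rmult_le_pos; lra|apply pow2_ge_0]. }
    apply Rle_trans with (x * ((a + b) * K)); [lra|].
    rewrite Rmult_assoc. apply Rmult_le_compat; auto.
    - apply Rmult_le_pos; lra.
    - apply Rmult_le_compat_l; lra. }
  assert (HX : 0 <= X * (a + b)) by (apply Rmult_le_pos; lra).
  assert (H2 : m ^ 2 <= X * (a + b) * (/ s + m)).
  { apply (Rmult_le_reg_r s); [lra|].
    replace (X * (a + b) * (/ s + m) * s) with (X * (a + b) * (1 + m * s)) by (field; lra).
    exact H1. }
  assert (His : / s <= / sinh T) by (apply Rinv_le_contravar; lra).
  assert (Hi0 : 0 < / sinh T) by now apply Rinv_0_lt_compat.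
  apply (Rmult_le_reg_r m); [lra|].
  replace (m * m) with (m ^ 2) by ring. apply Rle_trans with (1 := H2).
  rewrite (Rmult_assoc (X * (a + b))). apply Rmult_le_compat_l; auto. nra.
Qed.

(** * The Steklov spectrum of a conformal metric *)

Definition conformal_metric (T : R) (g : metric) (f : R -> R) : Prop :=
  (forall t, 0 <= t <= T -> 0 < f t)
  /\ forall t th, 0 <= t <= T ->
      g_tt g t th = f t ^ 2 /\ g_tth g t th = 0 /\ g_thth g t th = f t ^ 2.

Lemma conformal_sqrt_det T g f t th : conformal_metric T g f -> 0 <= t <= T ->
  sqrt_det g t th = f t ^ 2.
Proof.
  intros [Hf Hg] Ht. unfold sqrt_det. destruct (Hg t th Ht) as (-> & -> & ->).
  specialize (Hf t Ht).
  replace (f t ^ 2 * f t ^ 2 - 0 ^ 2) with ((f t ^ 2) ^ 2) by ring.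
  apply sqrt_pow2. apply pow2_ge_0.
Qed.

Lemma conformal_laplacian T g f u t th : conformal_metric T g f -> 0 < t < T ->
  laplacian g u t th = (d_t (d_t u) t th + d_th (d_th u) t th) / f t ^ 2.
Proof.
  intros Hm Ht. unfold laplacian.
  rewrite (conformal_sqrt_det T g f t th Hm) by lra. f_equal. f_equal.
  - apply Derive_ext_loc.
    assert (Hpos : 0 < Rmin t (T - t)) by (apply Rmin_glb_lt; lra).
    exists (mkposreal _ Hpos). intros s Hs.
    apply Rabs_lt_between' in Hs. simpl in Hs.
    pose proof (Rmin_l t (T - t)). pose proof (Rmin_r t (T - t)).
    assert (Hs' : 0 <= s <= T) by lra.
    rewrite (conformal_sqrt_det T g f s th Hm Hs').
    destruct Hm as [Hf Hg]. destruct (Hg s th Hs') as (_ & -> & ->).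
    specialize (Hf s Hs'). field. lra.
  - apply Derive_ext. intros w. assert (Ht' : 0 <= t <= T) by lra.
    rewrite (conformal_sqrt_det T g f t w Hm Ht').
    destruct Hm as [Hf Hg]. destruct (Hg t w Ht') as (-> & -> & _).
    specialize (Hf t Ht'). field. lra.
Qed.

Lemma conformal_normal_derivative T g f u s th : 0 < T -> conformal_metric T g f ->
  normal_derivative T g u s th
  = side_sign s * d_t u (side_pos T s) th / f (side_pos T s).
Proof.
  intros HT Hm. unfold normal_derivative, normal_t, normal_th.
  assert (Hs : 0 <= side_pos T s <= T) by (destruct s; simpl; lra).
  rewrite (conformal_sqrt_det T g f _ th Hm Hs).
  destruct Hm as [Hf Hg]. destruct (Hg _ th Hs) as (_ & -> & ->). specialize (Hf _ Hs).
  rewrite sqrt_pow2 by lra. field. lra.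
Qed.

Lemma steklov_eigenspace_conformal T g f lam phi : 0 < T -> conformal_metric T g f ->
  steklov_eigenspace T g lam phi <->
  smooth_boundary_fun phi /\ exists u, conformal_steklov (f 0) (f T) T lam phi u.
Proof.
  intros HT Hm.
  assert (Hf0 : 0 < f 0) by (apply Hm; lra). assert (HfT : 0 < f T) by (apply Hm; lra).
  unfold steklov_eigenspace, dirichlet_to_neumann, harmonic_extension, conformal_steklov.
  split; intros [Hs (u & Hu)]; split; auto; exists u.
  - destruct Hu as ((Hu & Hp & Hl & Hphi) & Hn). repeat split; auto.
    + intros t th Ht. specialize (Hl t th Ht).
      rewrite (conformal_laplacian T g f u t th Hm Ht) in Hl.
      assert (Hft : 0 < f t) by (apply Hm; lra). assert (0 < f t ^ 2) by now apply pow_lt.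
      apply Rmult_integral in Hl as [Hl|Hl]; auto.
      exfalso. revert Hl. apply Rinv_neq_0_compat. lra.
    + intros th. specialize (Hn Left th).
      rewrite (conformal_normal_derivative T g f u Left th HT Hm) in Hn. simpl in Hn.
      replace (d_t u 0 th) with (- (-1 * d_t u 0 th / f 0) * f 0) by (field; lra).
      rewrite Hn. ring.
    + intros th. specialize (Hn Right th).
      rewrite (conformal_normal_derivative T g f u Right th HT Hm) in Hn. simpl in Hn.
      replace (d_t u T th) with (1 * d_t u T th / f T * f T) by (field; lra).
      rewrite Hn. ring.
  - destruct Hu as (Hu & Hp & Hl & Hphi & H0 & H1). repeat split; auto.
    + intros t th Ht. rewrite (conformal_laplacian T g f u t th Hm Ht), Hl by auto.
      unfold Rdiv; ring.
    + intros s th. rewrite (conformal_normal_derivative T g f u s th HT Hm).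
      destruct s; simpl; rewrite ?H0, ?H1; field; lra.
Qed.

Lemma conformal_boundary_length T g f : 0 < T -> conformal_metric T g f ->
  boundary_length T g = 2 * PI * (f 0 + f T).
Proof.
  intros HT [Hf Hg]. unfold boundary_length.
  assert (H : forall t, 0 <= t <= T ->
    RInt (fun th => sqrt (g_thth g t th)) 0 (2 * PI) = 2 * PI * f t).
  { intros t Ht. rewrite (RInt_ext _ (fun _ => f t)).
    - rewrite RInt_const. unfold scal; simpl; unfold mult; simpl. ring.
    - intros th _. destruct (Hg t th Ht) as (_ & _ & ->).
      apply sqrt_pow2. left. now apply Hf. }
  rewrite !H by lra. ring.
Qed.

Lemma mode_fun_eigen T g f c n up : 0 < T -> conformal_metric T g f ->
  steklov_eigenspace T g (eig (f 0) (f T) T n up)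
    (mode_fun (f 0) T (eig (f 0) (f T) T n up) c n).
Proof.
  intros HT Hm. apply (steklov_eigenspace_conformal T g f); auto. split.
  - intros s. split.
    + apply (smooth_scal (hcos n (side_pos T s)
        - eig (f 0) (f T) T n up * f 0 * hsin n (side_pos T s)) (trig c n)), smooth_trig.
    + intros th. unfold mode_fun. now rewrite periodic_trig.
  - eexists. apply mode_fun_conformal. apply charpoly_root; auto; try (apply Hm; lra).
    now exists up.
Qed.

Lemma trig_lin_indep (c : nat -> R) (cs : nat -> bool) (ns : nat -> nat) (m : nat) :
  (forall i, (i <= m)%nat -> genuine (cs i) (ns i)) ->
  (forall i j, (i <= m)%nat -> (j <= m)%nat -> (cs i, ns i) = (cs j, ns j) -> i = j) ->
  (forall th, sum_f_R0 (fun i => c i * trig (cs i) (ns i) th) m = 0) ->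
  forall k, (k <= m)%nat -> c k = 0.
Proof.
  intros Hg Hinj Hsum k Hk.
  set (F := fun i th => trig (cs i) (ns i) th * trig (cs k) (ns k) th).
  destruct (period_int_sum F c m) as [_ HI].
  { intros i x _. unfold F. cont. }
  rewrite (sum_single _ m k) in HI; auto.
  - rewrite period_int_0 in HI.
    + pose proof (trig_norm_pos _ _ (Hg k Hk)) as Hpos. symmetry in HI.
      apply Rmult_integral in HI as [HI|HI]; auto. unfold F in HI. lra.
    + intros th.
      rewrite (sum_eq _ (fun i => c i * trig (cs i) (ns i) th * trig (cs k) (ns k) th)).
      * rewrite <- scal_sum, Hsum. ring.
      * intros i _. unfold F. ring.
  - intros i Hi Hik. unfold F. rewrite trig_orthogonal; [ring|].
    intro H. now apply Hik, Hinj.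
Qed.

(** From modes to eigenfunctions, orthogonality gives independence: distinct modes with
    the same root have distinct trigonometric factors, since the two roots of one
    frequency differ.  Conversely, if there were fewer modes than independent
    eigenfunctions, some nontrivial combination of the latter would have zero
    coefficients on the left circle at all the modes of root [lam], hence zero
    coefficients everywhere. *)
Lemma multiplicity T g f lam m : 0 < T -> conformal_metric T g f ->
  takes (mode_eig (f 0) (f T) T) lam (S m) <->
  exists phi : nat -> boundary_fun,
    (forall i, (i <= m)%nat -> steklov_eigenspace T g lam (phi i)) /\ lin_indep m phi.
Proof.
  intros HT Hm. set (a := f 0). set (b := f T).
  assert (Ha : 0 < a) by (apply Hm; lra). assert (Hb : 0 < b) by (apply Hm; lra).
  split.
  - intros Ht. apply takes_iff_injection in Ht as (idx & Hinj & Hval).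
    exists (fun i => mode_fun a T lam (is_cos (idx i)) (freq (idx i))). split.
    + intros i Hi. rewrite <- (Hval i Hi). now apply mode_fun_eigen.
    + intros c Hc. apply (trig_lin_indep c (fun i => is_cos (idx i)) (fun i => freq (idx i))).
      * intros i _. apply genuine_mode.
      * intros i j Hi Hj [= Hcos Hfreq]. apply Hinj; auto.
        rewrite (mode_index_surj (idx i)), (mode_index_surj (idx j)), Hcos, Hfreq. f_equal.
        pose proof (Hval i Hi) as Ei. pose proof (Hval j Hj) as Ej.
        unfold mode_eig in Ei, Ej. rewrite Hfreq in Ei.
        pose proof (eig_lt a b T (freq (idx j)) Ha Hb HT).
        fold a b in Ei, Ej.
        destruct (is_up (idx i)), (is_up (idx j)); auto; lra.
      * intros th. rewrite <- (Hc Left th). apply sum_eq. intros i _.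
        unfold mode_fun, side_pos. rewrite hcos_0, hsin_0. ring.
  - intros (phi & Heig & Hind).
    destruct (mode_eig_tends_to_infinity a b T Ha Hb HT lam) as (N & HN).
    set (J := filter (has_value (mode_eig a b T) lam) (seq 0 N)).
    assert (HJ : forall j, In j J <-> mode_eig a b T j = lam).
    { intros j. unfold J. rewrite filter_In, has_value_spec, in_seq. split; [tauto|].
      intros H. split; auto. specialize (HN j ltac:(lra)). lia. }
    assert (HJnd : NoDup J) by apply NoDup_filter, seq_NoDup.
    destruct (Nat.le_gt_cases (S m) (length J)) as [Hlen|Hlen].
    { exists (firstn (S m) J). split; [|split].
      - rewrite <- (firstn_skipn (S m) J) in HJnd. now apply NoDup_app_remove_r in HJnd.
      - now apply firstn_length_le.
      - intros i Hi. apply HJ. rewrite <- (firstn_skipn (S m) J). apply in_or_app. now left. }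
    exfalso.
    set (A := fun i k => boundary_fourier (is_cos (nth k J 0%nat)) (freq (nth k J 0%nat))
      (phi i) Left).
    destruct (homogeneous_system m A) as (c & (i0 & Hi0 & Hc0) & Hc).
    apply Hc0. apply (Hind c); auto. clear i0 Hi0 Hc0.
    assert (Hsol : forall i, (i <= m)%nat ->
      smooth_boundary_fun (phi i) /\ exists u, conformal_steklov a b T lam (phi i) u).
    { intros i Hi. apply (steklov_eigenspace_conformal T g f); auto. }
    set (Phi := fun s th => sum_f_R0 (fun i => c i * phi i s th) m).
    assert (Hcont : forall i s x, (i <= m)%nat -> continuous (phi i s) x).
    { intros i s x Hi. apply smooth_continuous. apply Hsol; auto. }
    assert (HPc : forall s x, continuous (Phi s) x).
    { intros s. apply (period_int_sum (fun i => phi i s) c m). auto. }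
    assert (HPF : forall d n s, boundary_fourier d n Phi s
      = sum_f_R0 (fun i => c i * boundary_fourier d n (phi i) s) m).
    { intros d n s. unfold boundary_fourier.
      destruct (period_int_sum (fun i th => phi i s th * trig d n th) c m) as [_ <-].
      - intros i x Hi. apply continuous_Rmult; [auto|apply continuous_trig].
      - apply period_int_ext. intros th. unfold Phi.
        rewrite Rmult_comm, scal_sum. apply sum_eq. intros; ring. }
    assert (HL : forall d n, boundary_fourier d n Phi Left = 0).
    { intros d n. destruct (classic (genuine d n)) as [Hg|Hg].
      - destruct (classic (charpoly a b T n lam = 0)) as [Hq|Hq].
        + apply charpoly_root in Hq as (up & Hup); auto.
          destruct (mode_index_spec n d up Hg) as (E1 & E2 & E3).
          assert (Hin : In (mode_index n d up) J)
            by (apply HJ; unfold mode_eig; now rewrite E1, E3).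
          destruct (In_nth J _ 0%nat Hin) as (k & Hk & Ek).
          rewrite HPF, <- (Hc k) by lia. unfold A. now rewrite Ek, E1, E2.
        + rewrite HPF, (sum_eq _ (fun _ => 0)), sum_cte; [ring|].
          intros i Hi. destruct (Hsol i Hi) as (_ & u & Hu).
          destruct (boundary_fourier_eigen a b T lam (phi i) u d n HT Hu) as [_ E].
          rewrite E; auto. ring.
      - destruct d; [exfalso; apply Hg; now right|].
        destruct n; [|exfalso; apply Hg; now left].
        apply period_int_0. intros th. unfold trig. simpl. rewrite Rmult_0_l, sin_0. ring. }
    assert (HR : forall d n, boundary_fourier d n Phi Right = 0).
    { intros d n. rewrite HPF.
      rewrite (sum_eq _ (fun i => c i * boundary_fourier d n (phi i) Left
        * (hcos n T - lam * a * hsin n T))).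
      - rewrite <- scal_sum, <- HPF, HL. ring.
      - intros i Hi. destruct (Hsol i Hi) as (_ & u & Hu).
        destruct (boundary_fourier_eigen a b T lam (phi i) u d n HT Hu) as [-> _]. ring. }
    intros s th. apply (vanishing_fourier_coefficients (Phi s)); auto.
    + intros x. apply sum_eq. intros i Hi. f_equal. apply Hsol; auto.
    + intros d n. destruct s; [exact (HL d n)|exact (HR d n)].
Qed.

(** The existence of a spectrum is what gives the choice made by [steklov] its meaning. *)
Lemma steklov_values T g f : 0 < T -> conformal_metric T g f ->
  (forall k, steklov T g k <= steklov T g (S k)) /\
  forall lam k, takes (steklov T g) lam (S k) <-> takes (mode_eig (f 0) (f T) T) lam (S k).
Proof.
  intros HT Hm.
  assert (Hex : exists sigma, steklov_spectrum T g sigma).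
  { destruct (sorted_sequence (mode_eig (f 0) (f T) T)) as (sigma & Hmono & Htakes).
    - apply mode_eig_tends_to_infinity; auto; apply Hm; lra.
    - exists sigma. split; auto. intros lam m.
      rewrite <- takes_iff_injection, Htakes. now apply multiplicity. }
  destruct (epsilon_spec (inhabits (fun _ : nat => 0)) _ Hex) as [Hmono Hspec].
  fold (steklov T g) in Hmono, Hspec. split; auto.
  intros lam k. rewrite takes_iff_injection, Hspec. symmetry. now apply multiplicity.
Qed.

(** * The upper bound *)

Lemma charpoly_nonpos a b T n x : 0 < a -> 0 < b -> 0 < T ->
  charpoly a b T n x <= 0 -> eig a b T n false <= x <= eig a b T n true.
Proof.
  intros Ha Hb HT Hx. rewrite charpoly_factor in Hx by auto.
  pose proof (eig_lt a b T n Ha Hb HT). pose proof (hsin_pos n T HT).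
  set (e := eig a b T n false) in *. set (e' := eig a b T n true) in *.
  assert (Hk : 0 < hsin n T * (a * b)) by (repeat apply Rmult_lt_0_compat; lra).
  assert (Hp : (x - e) * (x - e') <= 0).
  { apply (Rmult_le_reg_l (hsin n T * (a * b))); auto. lra. }
  split; apply Rnot_lt_le; intro; nra.
Qed.

Lemma eig_sum a b T n : 0 < a -> 0 < b -> 0 < T ->
  hsin n T * (a * b) * (eig a b T n false + eig a b T n true) = hcos n T * (a + b).
Proof.
  intros Ha Hb HT. pose proof (hsin_pos n T HT). unfold eig. field. repeat split; lra.
Qed.

Lemma charpoly_nonneg_right a b T n x : 0 < a -> 0 < b -> 0 < T ->
  0 <= charpoly a b T n x -> hcos n T * (a + b) <= 2 * (hsin n T * (a * b)) * x ->
  eig a b T n true <= x.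
Proof.
  intros Ha Hb HT Hx Hm. rewrite charpoly_factor in Hx by auto.
  rewrite <- (eig_sum a b T n Ha Hb HT) in Hm.
  pose proof (eig_lt a b T n Ha Hb HT). pose proof (hsin_pos n T HT).
  set (e := eig a b T n false) in *. set (e' := eig a b T n true) in *.
  assert (Hk : 0 < hsin n T * (a * b)) by (repeat apply Rmult_lt_0_compat; lra).
  set (k := hsin n T * (a * b)) in *. apply Rnot_lt_le. intro.
  assert (e + e' <= 2 * x) by (apply (Rmult_le_reg_l k); lra).
  assert (0 < (x - e) * (e' - x)) by (apply Rmult_lt_0_compat; lra).
  assert (0 < k * ((x - e) * (e' - x))) by now apply Rmult_lt_0_compat. lra.
Qed.

Lemma charpoly_nonneg_left a b T n x : 0 < a -> 0 < b -> 0 < T ->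
  0 <= charpoly a b T n x -> 2 * (hsin n T * (a * b)) * x <= hcos n T * (a + b) ->
  x <= eig a b T n false.
Proof.
  intros Ha Hb HT Hx Hm. rewrite charpoly_factor in Hx by auto.
  rewrite <- (eig_sum a b T n Ha Hb HT) in Hm.
  pose proof (eig_lt a b T n Ha Hb HT). pose proof (hsin_pos n T HT).
  set (e := eig a b T n false) in *. set (e' := eig a b T n true) in *.
  assert (Hk : 0 < hsin n T * (a * b)) by (repeat apply Rmult_lt_0_compat; lra).
  set (k := hsin n T * (a * b)) in *. apply Rnot_lt_le. intro.
  assert (2 * x <= e + e') by (apply (Rmult_le_reg_l k); lra).
  assert (0 < (x - e) * (e' - x)) by (apply Rmult_lt_0_compat; lra).
  assert (0 < k * ((x - e) * (e' - x))) by now apply Rmult_lt_0_compat. lra.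
Qed.

Lemma sinh_double x : sinh (2 * x) = 2 * sinh x * cosh x.
Proof.
  unfold sinh, cosh. replace (- (2 * x)) with (- x + - x) by ring.
  replace (2 * x) with (x + x) by ring. rewrite !exp_plus. field.
Qed.

Lemma cosh_double x : cosh (2 * x) = 1 + 2 * sinh x ^ 2.
Proof.
  assert (exp x * exp (- x) = 1) by (rewrite <- exp_plus, Rplus_opp_r; apply exp_0).
  unfold sinh, cosh. replace (- (2 * x)) with (- x + - x) by ring.
  replace (2 * x) with (x + x) by ring. rewrite !exp_plus. nra.
Qed.

Lemma hcos_1 T : hcos 1 T = cosh T.
Proof. unfold hcos. simpl INR. now rewrite Rmult_1_l. Qed.
Lemma hsin_1 T : hsin 1 T = sinh T.
Proof. unfold hsin. simpl INR. rewrite Rmult_1_l. field. Qed.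
Lemma hcos_2 T : hcos 2 T = 1 + 2 * sinh T ^ 2.
Proof. unfold hcos. simpl INR. now rewrite cosh_double. Qed.
Lemma hsin_2 T : hsin 2 T = sinh T * cosh T.
Proof. unfold hsin. simpl INR. rewrite sinh_double. field. Qed.

Lemma sqrt3_spec : 0 < sqrt 3 /\ sqrt 3 ^ 2 = 3.
Proof. split; [apply sqrt_lt_R0; lra|apply pow2_sqrt; lra]. Qed.

(** The value at which the modes of frequencies 1 and 2 cross for a = b; multiplied by
    the boundary length 2 pi (a + b) it becomes 4 pi sqrt 3. *)
Definition sharp_bound (a b : R) : R := 2 * sqrt 3 / (a + b).

Lemma charpoly_scaled a b T n k : 0 < a -> 0 < b ->
  charpoly a b T n (k / (a + b))
  = hsin n T * (k ^ 2 * (a * b / (a + b) ^ 2) + INR n ^ 2) - k * hcos n T.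
Proof. intros Ha Hb. unfold charpoly. field. lra. Qed.

Lemma aspect_bound a b : 0 < a -> 0 < b -> 0 < a * b / (a + b) ^ 2 <= / 4.
Proof.
  intros Ha Hb. assert (Hs : 0 < (a + b) ^ 2) by (apply pow_lt; lra). split.
  - apply Rdiv_lt_0_compat; auto. now apply Rmult_lt_0_compat.
  - apply (Rmult_le_reg_r ((a + b) ^ 2)); auto.
    replace (a * b / (a + b) ^ 2 * (a + b) ^ 2) with (a * b) by (field; lra).
    pose proof (pow2_ge_0 (a - b)). lra.
Qed.

Lemma eig_bound_0 a b T : 0 < a -> 0 < b -> 0 < T -> eig a b T 0 false <= sharp_bound a b.
Proof.
  intros Ha Hb HT. apply Rle_trans with 0.
  - apply charpoly_nonpos; auto. unfold charpoly. simpl INR. lra.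
  - destruct sqrt3_spec. apply Rdiv_le_0_compat; lra.
Qed.

Lemma eig_bound_1 a b T : 0 < a -> 0 < b -> 0 < T -> eig a b T 1 false <= sharp_bound a b.
Proof.
  intros Ha Hb HT. destruct sqrt3_spec as [H3 H3']. apply Rle_trans with (2 / (a + b)).
  - apply charpoly_nonpos; auto. rewrite charpoly_scaled, hcos_1, hsin_1 by auto.
    pose proof (aspect_bound a b Ha Hb) as Hp. set (p := a * b / (a + b) ^ 2) in *.
    pose proof (sinh_pos T HT). pose proof (cosh_gt_0 T). pose proof (cosh_sinh T).
    simpl INR. assert (sinh T <= cosh T) by nra.
    assert (sinh T * (2 ^ 2 * p + 1 ^ 2) <= sinh T * 2) by (apply Rmult_le_compat_l; lra).
    lra.
  - apply Rmult_le_compat_r; [|nra]. left. apply Rinv_0_lt_compat. lra.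
Qed.

(** Write p = a b / (a + b)^2 <= 1/4, s = sinh T, K = cosh T and q = sqrt 3.  If
    the first alternative fails then, by [charpoly_nonpos],
      s K (12 p + 4) > 2 q (1 + 2 s^2).
    With p <= 1/4 this forces s^2 >= 3, that is, T at or beyond the
    critical length; eliminating p between the same inequality and the two conditions of [charpoly_nonneg_right]
    for frequency 1 leaves inequalities in s alone, true for s^2 >= 3. *)
Lemma eig_bound_crossing a b T : 0 < a -> 0 < b -> 0 < T ->
  eig a b T 2 false <= sharp_bound a b \/ eig a b T 1 true <= sharp_bound a b.
Proof.
  intros Ha Hb HT. destruct sqrt3_spec as [H3 H3'].
  pose proof (aspect_bound a b Ha Hb) as Hp.
  destruct (Rle_or_lt (charpoly a b T 2 (sharp_bound a b)) 0) as [Hle|Hgt].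
  { left. now apply charpoly_nonpos. }
  right. apply charpoly_nonneg_right; auto; unfold sharp_bound in *.
  - rewrite charpoly_scaled, hcos_1, hsin_1 by auto.
    rewrite charpoly_scaled, hcos_2, hsin_2 in Hgt by auto.
    set (p := a * b / (a + b) ^ 2) in *.
    pose proof (sinh_pos T HT) as Hs. pose proof (cosh_gt_0 T) as HK.
    pose proof (cosh_sinh T) as HKs.
    set (s := sinh T) in *. set (K := cosh T) in *. set (q := sqrt 3) in *.
    simpl INR in *. replace ((1 + 1) ^ 2) with 4 in Hgt by ring.
    replace ((2 * q) ^ 2) with 12 in * by nra.
    assert (HsK : 0 < s * K) by now apply Rmult_lt_0_compat.
    (* Squared, 7 s K > 2 q (1 + 2 s^2) becomes (s^2 + 4) (s^2 - 3) > 0. *)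
    assert (Hs3 : 3 <= s ^ 2).
    { apply Rnot_lt_le. intro Hlt.
      assert (H7 : 2 * q * (1 + 2 * s ^ 2) < 7 * (s * K)) by nra.
      assert (Hsq : (2 * q * (1 + 2 * s ^ 2)) ^ 2 < (7 * (s * K)) ^ 2).
      { assert (0 < 2 * q * (1 + 2 * s ^ 2)).
        { pose proof (pow2_ge_0 s). apply Rmult_lt_0_compat; lra. }
        nra. }
      replace ((2 * q * (1 + 2 * s ^ 2)) ^ 2) with (4 * q ^ 2 * (1 + 2 * s ^ 2) ^ 2) in Hsq by ring.
      replace ((7 * (s * K)) ^ 2) with (49 * s ^ 2 * K ^ 2) in Hsq by ring.
      rewrite H3', HKs in Hsq.
      assert (0 < (s ^ 2 + 4) * (s ^ 2 - 3)) by lra. pose proof (pow2_ge_0 s). nra. }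
    assert (H23 : 3 * K <= 2 * q * s).
    { apply Rsqr_incr_0_var; [|apply Rmult_le_pos; lra]. unfold Rsqr. nra. }
    apply (Rmult_le_reg_l K); auto. rewrite Rmult_0_r. nra.
  - rewrite charpoly_scaled, hcos_2, hsin_2 in Hgt by auto. rewrite hcos_1, hsin_1.
    assert (E : 2 * (sinh T * (a * b)) * (2 * sqrt 3 / (a + b))
      = (4 * sqrt 3 * (a * b / (a + b) ^ 2) * sinh T) * (a + b)) by (field; lra).
    rewrite E. apply Rmult_le_compat_r; [lra|].
    set (p := a * b / (a + b) ^ 2) in *.
    pose proof (sinh_pos T HT) as Hs. pose proof (cosh_gt_0 T) as HK.
    pose proof (cosh_sinh T) as HKs.
    set (s := sinh T) in *. set (K := cosh T) in *. set (q := sqrt 3) in *.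
    simpl INR in *. replace ((1 + 1) ^ 2) with 4 in Hgt by ring.
    replace ((2 * q) ^ 2) with 12 in * by nra.
    assert (H4 : 4 * (s * K) <= q * (1 + 3 * s ^ 2)).
    { apply Rsqr_incr_0_var.
      - unfold Rsqr. replace (4 * (s * K) * (4 * (s * K))) with (16 * s ^ 2 * K ^ 2) by ring.
        replace (q * (1 + 3 * s ^ 2) * (q * (1 + 3 * s ^ 2)))
          with (q ^ 2 * (1 + 3 * s ^ 2) ^ 2) by ring.
        rewrite H3', HKs. pose proof (pow2_ge_0 s). nra.
      - apply Rmult_le_pos; [lra|]. pose proof (pow2_ge_0 s). lra. }
    (* multiply by sqrt 3 * K > 0 *)
    apply (Rmult_le_reg_l (q * K)); [now apply Rmult_lt_0_compat|].
    replace (q * K * (4 * q * p * s)) with (4 * q ^ 2 * (p * (s * K))) by ring.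
    rewrite H3'. replace (q * K * K) with (q * K ^ 2) by ring. rewrite HKs. nra.
Qed.

(** Modes 0; 2, 4; 6, 8; 3, 5 are respectively the constants, the two functions for
    eig 1 false, those for eig 2 false and those for eig 1 true. *)
Lemma steklov_4_upper T g f : 0 < T -> conformal_metric T g f ->
  normalized_steklov T g 4 <= 4 * PI * sqrt 3.
Proof.
  intros HT Hm. destruct (steklov_values T g f HT Hm) as [Hmono Htakes].
  assert (Ha : 0 < f 0) by (apply Hm; lra). assert (Hb : 0 < f T) by (apply Hm; lra).
  unfold normalized_steklov. rewrite (conformal_boundary_length T g f HT Hm).
  assert (H : steklov T g 4 <= sharp_bound (f 0) (f T)).
  { pose proof (eig_bound_0 _ _ _ Ha Hb HT) as B0. pose proof (eig_bound_1 _ _ _ Ha Hb HT) as B1.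
    destruct (eig_bound_crossing _ _ _ Ha Hb HT) as [B|B].
    - apply (sorted_le _ (mode_eig (f 0) (f T) T) _ [0; 2; 4; 6; 8]%nat); auto.
      + repeat constructor; simpl; intuition discriminate.
      + intros j Hj. simpl in Hj.
        destruct Hj as [<-|[<-|[<-|[<-|[<-|[]]]]]]; [exact B0|exact B1|exact B1|exact B|exact B].
    - apply (sorted_le _ (mode_eig (f 0) (f T) T) _ [0; 2; 4; 3; 5]%nat); auto.
      + repeat constructor; simpl; intuition discriminate.
      + intros j Hj. simpl in Hj.
        destruct Hj as [<-|[<-|[<-|[<-|[<-|[]]]]]]; [exact B0|exact B1|exact B1|exact B|exact B]. }
  pose proof PI_RGT_0.
  replace (4 * PI * sqrt 3) with (sharp_bound (f 0) (f T) * (2 * PI * (f 0 + f T)))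
    by (unfold sharp_bound; field; lra).
  apply Rmult_le_compat_r; auto. apply Rmult_le_pos; lra.
Qed.

(** * The critical length and the lower bound *)

(** With S = sinh (s / 2), the equation reads 4 S^2 = cosh s = 1 + 2 S^2. *)
Lemma critical_equation_iff s : 0 < s -> (2 * tanh s = coth (s / 2) <-> cosh s = 2).
Proof.
  intros Hs. assert (Hs2 : 0 < s / 2) by lra.
  pose proof (sinh_pos _ Hs2) as HS. pose proof (cosh_gt_0 (s / 2)) as HC.
  pose proof (sinh_double (s / 2)) as E1. pose proof (cosh_double (s / 2)) as E2.
  replace (2 * (s / 2)) with s in * by field.
  unfold tanh, coth. rewrite E1, E2. set (S := sinh (s / 2)) in *. set (C := cosh (s / 2)) in *.
  assert (Hc : 0 < 1 + 2 * S ^ 2) by (pose proof (pow2_ge_0 S); lra).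
  split; intros H.
  - assert (E : 4 * S ^ 2 * C = (1 + 2 * S ^ 2) * C).
    { replace (4 * S ^ 2 * C) with (2 * (2 * S * C / (1 + 2 * S ^ 2)) * (S * (1 + 2 * S ^ 2)))
        by (field; lra).
      rewrite H. field. lra. }
    apply Rmult_eq_reg_r in E; lra.
  - rewrite H. apply (Rmult_eq_reg_r S); [|lra].
    replace (C / S * S) with C by (field; lra).
    replace (2 * (2 * S * C / 2) * S) with (2 * S ^ 2 * C) by field.
    replace (2 * S ^ 2) with 1 by lra. ring.
Qed.

Lemma T21_spec : 0 < T21 /\ cosh T21 = 2 /\ sinh T21 = sqrt 3.
Proof.
  destruct sqrt3_spec as [H3 H3'].
  assert (Hex : exists s, unique (fun s => 0 < s /\ 2 * tanh s = coth (s / 2)) s).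
  { exists (ln (2 + sqrt 3)).
    assert (Hpos : 0 < ln (2 + sqrt 3)) by (rewrite <- ln_1; apply ln_increasing; lra).
    assert (Hinv : / (2 + sqrt 3) = 2 - sqrt 3).
    { apply (Rmult_eq_reg_l (2 + sqrt 3)); [|lra]. rewrite Rinv_r by lra. lra. }
    split.
    - split; auto. apply critical_equation_iff; auto. unfold cosh.
      rewrite exp_Ropp, exp_ln, Hinv by lra. field.
    - intros s [Hs Heq]. apply critical_equation_iff in Heq; auto.
      apply exp_inv. rewrite exp_ln by lra.
      assert (H1 : 1 < exp s) by (rewrite <- exp_0; now apply exp_increasing).
      assert (He : exp s * exp (- s) = 1) by (rewrite <- exp_plus, Rplus_opp_r; apply exp_0).
      unfold cosh in Heq.
      assert (Hf : (exp s - (2 + sqrt 3)) * (exp s - (2 - sqrt 3)) = 0).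
      { replace (exp (- s)) with (4 - exp s) in He by lra. nra. }
      apply Rmult_integral in Hf. destruct Hf; [lra|]. nra. }
  destruct (epsilon_spec (inhabits 0) _ Hex) as [[Hpos Heq] _].
  fold T21 in Hpos, Heq. apply critical_equation_iff in Heq; auto.
  split; [|split]; auto.
  pose proof (cosh_sinh T21) as E. rewrite Heq in E. pose proof (sinh_pos T21 Hpos).
  nra.
Qed.

(** For a = b, [charpoly] at the bound sqrt 3 / a is S (n^2 + 3) - 2 sqrt 3 K.  It is 0
    for n = 1 and n = 2, where S = sqrt 3, K = 2 and S = 2 sqrt 3, K = 7: the bound is
    the upper root of frequency 1 and the lower root of frequency 2.  For n >= 3 it
    is positive, because the sign is that of S^2 (n^2 - 3)^2 - 12. *)
Lemma symmetric_critical_lower (a : R) (n : nat) (up : bool) : 0 < a ->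
  (2 <= n)%nat \/ n = 1%nat /\ up = true -> sharp_bound a a <= eig a a T21 n up.
Proof.
  intros Ha Hn. destruct T21_spec as (HT & HK & Hs). destruct sqrt3_spec as [H3 H3'].
  assert (Hlow : (2 <= n)%nat -> sharp_bound a a <= eig a a T21 n false).
  { intros Hn2. pose proof (hcos_hsin n T21) as Hhyp.
    pose proof (hcos_pos n T21) as HKn. pose proof (hsin_pos n T21 HT) as HSn.
    assert (Hn2' : 2 <= INR n) by (apply (le_INR 2); auto).
    assert (HS : 12 <= hsin n T21 ^ 2 * (INR n ^ 2 - 3) ^ 2).
    { destruct (Nat.eq_dec n 2) as [->|Hn3].
      - rewrite hsin_2, Hs, HK. simpl INR.
        replace ((sqrt 3 * 2) ^ 2 * ((1 + 1) ^ 2 - 3) ^ 2) with (4 * sqrt 3 ^ 2) by ring. lra.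
      - assert (Hge : sinh T21 <= hsin n T21) by (apply hsin_ge_sinh; auto; lia).
        rewrite Hs in Hge.
        assert (Hn3' : 3 <= INR n) by (replace 3 with (INR 3) by (simpl; ring); apply le_INR; lia).
        assert (3 <= hsin n T21 ^ 2) by nra.
        assert (6 <= INR n ^ 2 - 3) by nra.
        assert (36 <= (INR n ^ 2 - 3) ^ 2) by nra.
        nra. }
    set (m := INR n) in *. set (S := hsin n T21) in *. set (K := hcos n T21) in *.
    apply charpoly_nonneg_left; auto; unfold sharp_bound.
    - rewrite charpoly_scaled by auto. fold S K m.
      replace (a * a / (a + a) ^ 2) with (/ 4) by (field; lra).
      replace ((2 * sqrt 3) ^ 2 * / 4) with (sqrt 3 ^ 2) by field. rewrite H3'.
      assert (2 * sqrt 3 * K <= S * (3 + m ^ 2)); [|lra].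
      apply Rsqr_incr_0_var; [|apply Rmult_le_pos; [lra|pose proof (pow2_ge_0 m); lra]].
      unfold Rsqr.
      replace (2 * sqrt 3 * K * (2 * sqrt 3 * K)) with (4 * sqrt 3 ^ 2 * K ^ 2) by ring.
      replace (S * (3 + m ^ 2) * (S * (3 + m ^ 2)))
        with (S ^ 2 * (m ^ 2 - 3) ^ 2 + 12 * (m ^ 2 * S ^ 2)) by ring.
      rewrite H3', Hhyp. lra.
    - fold S K. replace (2 * (S * (a * a)) * (2 * sqrt 3 / (a + a)))
        with (2 * a * (sqrt 3 * S)) by (field; lra).
      assert (HSK : sqrt 3 * S <= K).
      { apply Rsqr_incr_0_var; [|lra]. unfold Rsqr.
        replace (sqrt 3 * S * (sqrt 3 * S)) with (sqrt 3 ^ 2 * S ^ 2) by ring.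
        replace (K * K) with (K ^ 2) by ring. rewrite H3', Hhyp.
        pose proof (pow2_ge_0 S). assert (4 <= m ^ 2) by nra. nra. }
      replace (K * (a + a)) with (2 * a * K) by ring.
      apply Rmult_le_compat_l; lra. }
  destruct Hn as [Hn|[-> ->]].
  - destruct up; [|now apply Hlow].
    apply Rle_trans with (eig a a T21 n false); [now apply Hlow|].
    left. now apply eig_lt.
  - apply charpoly_nonpos; auto. unfold sharp_bound.
    rewrite charpoly_scaled, hcos_1, hsin_1, HK, Hs by auto. simpl INR.
    replace (a * a / (a + a) ^ 2) with (/ 4) by (field; lra).
    replace ((2 * sqrt 3) ^ 2 * / 4) with (sqrt 3 ^ 2) by field. rewrite H3'. lra.
Qed.

(** Only modes 0, 1 (frequency 0) and 2, 4 (lower root of frequency 1) may lie below the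
    bound. *)
Lemma steklov_4_lower g f : conformal_metric T21 g f -> f T21 = f 0 ->
  4 * PI * sqrt 3 <= normalized_steklov T21 g 4.
Proof.
  intros Hm Hsym. destruct T21_spec as (HT & HK & Hs).
  destruct (steklov_values T21 g f HT Hm) as [Hmono Htakes].
  unfold normalized_steklov. rewrite (conformal_boundary_length T21 g f HT Hm).
  rewrite Hsym in *. assert (Ha : 0 < f 0) by (apply Hm; lra).
  assert (H : sharp_bound (f 0) (f 0) <= steklov T21 g 4).
  { apply (sorted_ge _ (mode_eig (f 0) (f 0) T21) _ [0; 1; 2; 4]%nat); auto.
    intros j Hj. unfold mode_eig. apply symmetric_critical_lower; auto.
    pose proof (mode_index_surj j) as Hc.
    destruct (freq j) as [|[|n]] eqn:Hf; [| |left; lia].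
    - exfalso. apply Hj. pose proof (genuine_mode j) as [Hg|Hg]; [congruence|].
      rewrite Hg in Hc. rewrite Hc. destruct (is_up j); simpl; tauto.
    - right. split; auto. destruct (is_up j) eqn:Hu; auto. exfalso. apply Hj.
      rewrite Hc. destruct (is_cos j); simpl; tauto. }
  pose proof PI_RGT_0.
  replace (4 * PI * sqrt 3) with (sharp_bound (f 0) (f 0) * (2 * PI * (f 0 + f 0)))
    by (unfold sharp_bound; field; lra).
  apply Rmult_le_compat_r; auto. apply Rmult_le_pos; lra.
Qed.

(** * The critical band *)

(** The algebra generated by the smooth functions and 1 / sqrt q is closed under
    differentiation, as (q^(-1/2))' = - q'/2 (q^(-1/2))^3; it contains sqrt q. *)
Inductive sqrt_algebra (q : R -> R) : (R -> R) -> Prop :=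
| sqrt_algebra_smooth p : smooth p -> sqrt_algebra q p
| sqrt_algebra_inv : sqrt_algebra q (fun x => / sqrt (q x))
| sqrt_algebra_plus p r : sqrt_algebra q p -> sqrt_algebra q r ->
    sqrt_algebra q (fun x => p x + r x)
| sqrt_algebra_mult p r : sqrt_algebra q p -> sqrt_algebra q r ->
    sqrt_algebra q (fun x => p x * r x).

Lemma smooth_sqrt_algebra q : smooth q -> (forall x, 0 < q x) ->
  forall p, sqrt_algebra q p -> smooth p.
Proof.
  intros Hq Hpos. apply smooth_class. intros p Hp.
  induction Hp as [p Hp| |p r Hp IHp Hr IHr|p r Hp IHp Hr IHr].
  - exists (Derive p). split; [now apply sqrt_algebra_smooth, smooth_Derive|].
    intros x. now apply Derive_correct, smooth_ex_derive.
  - exists (fun x => (- / 2 * Derive q x) *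
      (/ sqrt (q x) * (/ sqrt (q x) * / sqrt (q x)))). split.
    + apply (sqrt_algebra_mult q (fun x => - / 2 * Derive q x)).
      * now apply sqrt_algebra_smooth, smooth_scal, smooth_Derive.
      * apply (sqrt_algebra_mult q (fun x => / sqrt (q x)));
          [|apply (sqrt_algebra_mult q (fun x => / sqrt (q x)))]; apply sqrt_algebra_inv.
    + intros x. pose proof (sqrt_lt_R0 _ (Hpos x)).
      auto_derive.
      * repeat split; auto; [now apply smooth_ex_derive|lra].
      * change (Derive (fun y => q y) x) with (Derive q x). field. lra.
  - destruct IHp as (dp & Cp & Dp), IHr as (dr & Cr & Dr).
    exists (fun x => dp x + dr x). split; [now apply sqrt_algebra_plus|].
    intros x. now apply is_derive_Rplus.
  - destruct IHp as (dp & Cp & Dp), IHr as (dr & Cr & Dr).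
    exists (fun x => dp x * r x + p x * dr x). split.
    + apply (sqrt_algebra_plus q (fun x => dp x * r x) (fun x => p x * dr x));
        now apply sqrt_algebra_mult.
    + intros x. now apply is_derive_Rmult.
Qed.

Lemma smooth_const k : smooth (fun _ => k).
Proof.
  apply (smooth_second_order _ (fun _ => 0) 0); intros x.
  - apply (is_derive_const k).
  - rewrite Rmult_0_l. apply (is_derive_const 0).
Qed.

Lemma smooth_plus p r : smooth p -> smooth r -> smooth (fun x => p x + r x).
Proof.
  intros Hp Hr. apply (smooth_sqrt_algebra (fun _ => 1)).
  - apply smooth_const.
  - intros; lra.
  - apply sqrt_algebra_plus; now apply sqrt_algebra_smooth.
Qed.

Lemma smooth_sqrt q : smooth q -> (forall x, 0 < q x) -> smooth (fun x => sqrt (q x)).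
Proof.
  intros Hq Hpos.
  replace (fun x => sqrt (q x)) with (fun x => q x * / sqrt (q x)).
  - apply (smooth_sqrt_algebra q); auto.
    apply sqrt_algebra_mult; [now apply sqrt_algebra_smooth|apply sqrt_algebra_inv].
  - apply functional_extensionality. intros x.
    pose proof (sqrt_lt_R0 _ (Hpos x)). rewrite <- (sqrt_sqrt (q x)) at 1 by (left; auto).
    field. lra.
Qed.

(** Equal to 4 sinh^2 x + 4 cosh^2 (2 x) for x = t - T21 / 2; the linearised form makes its
    smoothness immediate. *)
Definition conformal_factor_sq (t : R) : R :=
  2 * cosh (2 * (t - T21 / 2)) + 2 * cosh (4 * (t - T21 / 2)).

Definition conformal_factor (t : R) : R := sqrt (conformal_factor_sq t).

Lemma conformal_factor_sq_pos t : 0 < conformal_factor_sq t.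
Proof.
  unfold conformal_factor_sq.
  pose proof (cosh_gt_0 (2 * (t - T21 / 2))). pose proof (cosh_gt_0 (4 * (t - T21 / 2))). lra.
Qed.

Lemma smooth_cosh_affine k c : smooth (fun t => cosh (k * (t - c))).
Proof.
  apply (smooth_second_order _ (fun t => k * sinh (k * (t - c))) (k ^ 2)); intros t.
  - evar_last.
    + apply (is_derive_comp cosh (fun t => k * (t - c))); [apply is_derive_cosh|].
      auto_derive; auto.
    + unfold scal; simpl; unfold mult; simpl. ring.
  - evar_last.
    + apply (is_derive_scal (fun t => sinh (k * (t - c)))).
      apply (is_derive_comp sinh (fun t => k * (t - c))); [apply is_derive_sinh|].
      auto_derive; auto.
    + unfold scal; simpl; unfold mult; simpl. ring.
Qed.

Lemma smooth_conformal_factor : smooth conformal_factor.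
Proof.
  apply smooth_sqrt; [|apply conformal_factor_sq_pos].
  apply (smooth_plus (fun t => 2 * cosh (2 * (t - T21 / 2)))
    (fun t => 2 * cosh (4 * (t - T21 / 2)))); apply smooth_scal, smooth_cosh_affine.
Qed.

Lemma conformal_factor_symmetric : conformal_factor T21 = conformal_factor 0.
Proof.
  assert (Heven : forall x, cosh (- x) = cosh x).
  { intros x. unfold cosh. rewrite Ropp_involutive. now rewrite Rplus_comm. }
  unfold conformal_factor, conformal_factor_sq.
  rewrite <- (Heven (2 * (0 - _))), <- (Heven (4 * (0 - _))).
  f_equal. f_equal; f_equal; f_equal; field.
Qed.

Lemma moebius_tangent_t c t th :
  tangent_t (fun t th => moebius (t - c) th) t th =
  mkR4 (2 * cosh (t - c) * cos th) (2 * cosh (t - c) * sin th)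
    (2 * sinh (2 * (t - c)) * cos (2 * th)) (2 * sinh (2 * (t - c)) * sin (2 * th)).
Proof.
  assert (Hs : forall k, is_derive (fun t => 2 * sinh (t - c) * k) t (2 * cosh (t - c) * k)).
  { intros k. auto_derive; auto. unfold Rminus. ring. }
  assert (Hc : forall k, is_derive (fun t => cosh (2 * (t - c)) * k) t
    (2 * sinh (2 * (t - c)) * k)).
  { intros k. auto_derive; auto. unfold Rminus. ring. }
  unfold tangent_t, vec_map, d_t, moebius. simpl.
  f_equal; apply is_derive_unique; auto.
Qed.

Lemma moebius_tangent_th c t th :
  tangent_th (fun t th => moebius (t - c) th) t th =
  mkR4 (- (2 * sinh (t - c) * sin th)) (2 * sinh (t - c) * cos th)
    (- (2 * cosh (2 * (t - c)) * sin (2 * th))) (2 * cosh (2 * (t - c)) * cos (2 * th)).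
Proof.
  unfold tangent_th, vec_map, d_th, moebius. simpl.
  f_equal; apply is_derive_unique; auto_derive; auto; ring.
Qed.

Lemma moebius_metric t th :
  g_tt critical_moebius_metric t th = conformal_factor t ^ 2 /\
  g_tth critical_moebius_metric t th = 0 /\
  g_thth critical_moebius_metric t th = conformal_factor t ^ 2.
Proof.
  unfold conformal_factor. rewrite pow2_sqrt by (left; apply conformal_factor_sq_pos).
  unfold critical_moebius_metric, induced_metric, conformal_factor_sq. simpl.
  rewrite moebius_tangent_t, moebius_tangent_th. unfold dot. simpl.
  set (x := t - T21 / 2). replace (4 * x) with (2 * (2 * x)) by ring.
  rewrite (cosh_double (2 * x)), (cosh_double x).
  pose proof (cosh_sinh x) as E1. pose proof (cosh_sinh (2 * x)) as E2.
  rewrite cosh_double in E2.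
  pose proof (sin2_cos2 th) as S1. pose proof (sin2_cos2 (2 * th)) as S2. unfold Rsqr in S1, S2.
  set (s := sin th) in *. set (c := cos th) in *.
  set (s2 := sin (2 * th)) in *. set (c2 := cos (2 * th)) in *.
  set (Sx := sinh x) in *. set (Cx := cosh x) in *. set (S2x := sinh (2 * x)) in *.
  split; [|split].
  - transitivity (4 * Cx ^ 2 * (s * s + c * c) + 4 * S2x ^ 2 * (s2 * s2 + c2 * c2)); [ring|].
    rewrite S1, S2, E1. ring.
  - ring.
  - transitivity (4 * Sx ^ 2 * (s * s + c * c)
      + 4 * (1 + 2 * Sx ^ 2) ^ 2 * (s2 * s2 + c2 * c2)); [ring|].
    rewrite S1, S2, E2. ring.
Qed.

Lemma critical_conformal : conformal_metric T21 critical_moebius_metric conformal_factor.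
Proof.
  split.
  - intros t _. apply sqrt_lt_R0, conformal_factor_sq_pos.
  - intros t th _. apply moebius_metric.
Qed.

(** Here sinh^2 t = 1/2 and cosh (2 t) = 2.  The second is the defining equation
    cosh T21 = 2 of the critical length, and it makes the factors 2 cosh t / (2 sinh t)
    and 2 sinh (2 t) / cosh (2 t) between X_t and X agree. *)
Lemma moebius_free_boundary t th : t = - (T21 / 2) \/ t = T21 / 2 ->
  dot (moebius t th) (moebius t th) = 6 /\
  tangent_t moebius t th = comb (2 * sinh t * cosh t) (moebius t th) 0 (moebius t th).
Proof.
  intros Ht. destruct T21_spec as (_ & HK & _).
  assert (Hc : cosh (2 * t) = 2).
  { destruct Ht as [->| ->].
    - replace (2 * - (T21 / 2)) with (- T21) by field. rewrite <- HK.
      unfold cosh. rewrite Ropp_involutive. now rewrite Rplus_comm.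
    - replace (2 * (T21 / 2)) with T21 by field. exact HK. }
  pose proof (cosh_double t) as E. rewrite Hc in E.
  assert (HS : sinh t ^ 2 = / 2) by lra.
  pose proof (sin2_cos2 th) as S1. pose proof (sin2_cos2 (2 * th)) as S2. unfold Rsqr in S1, S2.
  split.
  - unfold dot, moebius. simpl. rewrite Hc.
    transitivity (4 * sinh t ^ 2 * (sin th * sin th + cos th * cos th)
      + 4 * (sin (2 * th) * sin (2 * th) + cos (2 * th) * cos (2 * th))); [ring|].
    rewrite S1, S2, HS. field.
  - replace (tangent_t moebius t th) with (tangent_t (fun t th => moebius (t - 0) th) t th).
    2:{ f_equal. apply functional_extensionality; intros s.
        apply functional_extensionality; intros w. now rewrite Rminus_0_r. }
    rewrite moebius_tangent_t, Rminus_0_r, sinh_double.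
    unfold comb, moebius. simpl. rewrite Hc.
    f_equal; [replace (2 * cosh t) with (4 * sinh t ^ 2 * cosh t) by (rewrite HS; field)
      |replace (2 * cosh t) with (4 * sinh t ^ 2 * cosh t) by (rewrite HS; field)| |]; ring.
Qed.

Lemma moebius_meets_sphere :
  meets_sphere_orthogonally moebius (- (T21 / 2)) (T21 / 2) (sqrt 6).
Proof.
  intros t th Ht. destruct (moebius_free_boundary t th Ht) as [Hnorm Htan].
  rewrite pow2_sqrt by lra. split; auto.
  intros p q nu Hnu v Hv.
  assert (Hth : tangent_th moebius t th =
    tangent_th (fun t th => moebius (t - 0) th) t th).
  { f_equal. apply functional_extensionality; intros s.
    apply functional_extensionality; intros w. now rewrite Rminus_0_r. }
  rewrite moebius_tangent_th, Rminus_0_r in Hth.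
  unfold nu in *. rewrite Htan, Hth in *. clear Htan Hth nu.
  unfold dot, comb, moebius in *. simpl in *.
  set (S := sinh t) in *. set (C2 := cosh (2 * t)) in *. set (C := cosh t) in *.
  pose proof (sin2_cos2 th) as S1. pose proof (sin2_cos2 (2 * th)) as S2. unfold Rsqr in S1, S2.
  assert (Hq : q * (4 * S ^ 2 * (sin th * sin th + cos th * cos th)
    + 4 * C2 ^ 2 * (sin (2 * th) * sin (2 * th) + cos (2 * th) * cos (2 * th))) = 0).
  { rewrite <- Hnu. ring. }
  rewrite S1, S2 in Hq. apply Rmult_integral in Hq as [->|Hq].
  - transitivity (p * (2 * S * C) * (x1 v * (2 * S * cos th) + x2 v * (2 * S * sin th)
      + x3 v * (C2 * cos (2 * th)) + x4 v * (C2 * sin (2 * th)))); [ring|].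
    rewrite Hv. ring.
  - exfalso. pose proof (cosh_gt_0 (2 * t)) as HC. fold C2 in HC.
    pose proof (pow2_ge_0 S). assert (0 < C2 ^ 2) by now apply pow_lt. lra.
Qed.

Theorem theorem3p2 :
  (0 < T21 /\ rotationally_symmetric T21 critical_moebius_metric)
  /\ (forall (T : R) (g : metric), 0 < T -> rotationally_symmetric T g ->
        normalized_steklov T g 4 <= normalized_steklov T21 critical_moebius_metric 4)
  /\ (exists r : R, 0 < r
        /\ meets_sphere_orthogonally moebius (- (T21 / 2)) (T21 / 2) r).
Proof.
  split; [split|split].
  - apply T21_spec.
  - exists conformal_factor. split; [|exact critical_conformal].
    exists conformal_factor. split; [apply smooth_conformal_factor|reflexivity].
  - intros T g HT (f & _ & Hf). apply Rle_trans with (4 * PI * sqrt 3).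
    + now apply (steklov_4_upper T g f).
    + apply (steklov_4_lower _ conformal_factor critical_conformal).
      apply conformal_factor_symmetric.
  - exists (sqrt 6). split; [apply sqrt_lt_R0; lra|exact moebius_meets_sphere].
Qed.
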